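(* Let $a>-\frac14$, $a\ne0$, $b>0$, and let $V\in C[0,\infty)$ be bounded and real-valued. Let $A$ be the operator on $L^2(\mathbb R^+)$ with domain $C_c^\infty(\mathbb R^+)$ given by $$[Au](r)=-u''(r)+\frac{a}{r^2}u(r)+br^2u(r)+V(r)u(r),$$ assume that its closure is self-adjoint, and denote this self-adjoint closure by $\mathcal A$. Let $-\frac14<\alpha<a$ and set $$Q(r)=\frac{a-\alpha}{r^2}+br^2+V(r),$$ so that $[Au](r)=-u''(r)+\frac{\alpha}{r^2}u(r)+Q(r)u(r)$. Let $Q=Q_+-Q_-$ with $Q_\pm\ge0$, and let $\kappa\ge\frac32$. Then the number $\nu(\mathcal A)$ of negative eigenvalues of $\mathcal A$ is bounded by $$\nu(\mathcal A)\le\frac{(\kappa-1)^{\kappa-1}\,\Gamma(2\kappa)}{(4\alpha+1)^{\kappa-\frac12}\,\kappa^\kappa\,\Gamma(\kappa)^2}\int_0^\infty r^{2\kappa-1}Q_-(r)^\kappa\,dr.$$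
   Context: $\mathbb R^+=(0,\infty)$; $\Gamma$ is the Gamma function. $Q_\pm$ are (measurable) nonnegative functions on $(0,\infty)$. *)

(* Defs.v *)
From HB Require Import structures.
From mathcomp Require Import all_boot all_order all_algebra.
From mathcomp Require Import complex.
From mathcomp Require Import all_classical all_reals all_analysis.

Set Implicit Arguments.
Unset Strict Implicit.
Unset Printing Implicit Defensive.

Import Order.TTheory GRing.Theory Num.Theory.
Import numFieldNormedType.Exports.

Local Open Scope classical_set_scope.
Local Open Scope ring_scope.
Local Open Scope complex_scope.

(* Elements of the complex Hilbert space L^2(0, +oo) are represented by
   functions R -> R[i] that are measurable and square-integrable on (0, +oo).
   Two functions represent the same element when they agree almost everywhere
   on (0, +oo); values outside (0, +oo) are irrelevant.  An (unbounded) operator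
   is represented by its graph, a set of pairs of such functions. *)

Definition Rpos {R : realType} : set R := `]0, +oo[%classic.

Definition Gamma {R : realType} (x : R) : R :=
  \int[lebesgue_measure]_(t in Rpos) (t `^ (x - 1) * expR (- t)).

Section HilbertSpace.
Context {R : realType}.
Implicit Types (f g u v : R -> R[i]) (G : set ((R -> R[i]) * (R -> R[i]))).

Definition reF f : R -> R := fun r => complex.Re (f r).
Definition imF f : R -> R := fun r => complex.Im (f r).

Definition sqnormL2 f : \bar R :=
  (\int[lebesgue_measure]_(r in Rpos) ((reF f r ^+ 2 + imF f r ^+ 2)%:E))%E.

Definition L2 : set (R -> R[i]) := [set f |
  [/\ measurable_fun Rpos (reF f), measurable_fun Rpos (imF f) &
      (sqnormL2 f < +oo)%E]].

Definition cintegral f : R[i] :=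
  (\int[lebesgue_measure]_(r in Rpos) reF f r) +i*
  (\int[lebesgue_measure]_(r in Rpos) imF f r).

Definition innerL2 f g : R[i] := cintegral (fun r => f r * (g r)^*%R).

Definition cvgL2 (f_ : nat -> R -> R[i]) f : Prop :=
  (fun n => sqnormL2 (fun r => f_ n r - f r)) @ \oo --> 0%E.

Definition dom G : set (R -> R[i]) := [set u | exists v, G (u, v)].

Definition densely_defined G : Prop :=
  forall f, L2 f -> exists f_ : nat -> R -> R[i],
    (forall n, dom G (f_ n)) /\ cvgL2 f_ f.

Definition closure_op G : set ((R -> R[i]) * (R -> R[i])) := [set w |
  [/\ L2 w.1, L2 w.2 &
      exists u_ v_ : nat -> R -> R[i],
        [/\ forall n, G (u_ n, v_ n), cvgL2 u_ w.1 & cvgL2 v_ w.2]]].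

Definition adjoint_op G : set ((R -> R[i]) * (R -> R[i])) := [set w |
  [/\ L2 w.1, L2 w.2 &
      forall u v, G (u, v) -> innerL2 v w.1 = innerL2 u w.2]].

(* A densely defined relation equal to its adjoint is automatically the graph
   of a (single-valued) linear operator. *)
Definition self_adjoint G : Prop := densely_defined G /\ adjoint_op G = G.

Definition lin_indep n (f : 'I_n -> R -> R[i]) : Prop :=
  forall c : 'I_n -> R[i],
    {ae lebesgue_measure, forall r : R, Rpos r -> \sum_(i < n) c i * f i r = 0} ->
    forall i, c i = 0.

Definition dimL2 (E : set (R -> R[i])) : \bar R :=
  ereal_sup [set n%:R%:E | n in [set n : nat |
    exists f : 'I_n -> R -> R[i], (forall i, E (f i)) /\ lin_indep f]].

Definition eigenspace_op G (lambda : R) : set (R -> R[i]) :=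
  [set u | G (u, fun r => lambda%:C * u r)].

(* Counted with multiplicity; the value is +oo when there are infinitely many.
   Real lambda suffice since a negative number is real. *)
Definition num_neg_eigenvalues G : \bar R :=
  \esum_(lambda in [set lambda : R | lambda < 0]) dimL2 (eigenspace_op G lambda).

End HilbertSpace.

Section RadialOperator.
Context {R : realType}.
Implicit Types u : R -> R[i].

Definition smooth (h : R -> R) : Prop :=
  forall (n : nat) (x : R), derivable (derive1n n h) x 1.

(* C_c^oo(0, +oo), its elements being extended by 0 to the whole line *)
Definition Ccoo u : Prop :=
  let supp := closure [set r : R | u r != 0] in
  [/\ smooth (reF u), smooth (imF u), compact supp & supp `<=` Rpos].

Definition cderive2 u : R -> R[i] :=
  fun r => derive1n 2 (reF u) r +i* derive1n 2 (imF u) r.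

Definition radial_expr (a b : R) (V : R -> R) u : R -> R[i] := fun r =>
  - cderive2 u r + (a / r ^+ 2)%:C * u r + (b * r ^+ 2)%:C * u r
  + (V r)%:C * u r.

Definition radial_op (a b : R) (V : R -> R) : set ((R -> R[i]) * (R -> R[i])) :=
  [set (u, radial_expr a b V u) | u in Ccoo].

End RadialOperator.

(* Main.v *)
Require Import Defs.
From HB Require Import structures.
From mathcomp Require Import all_boot all_order all_algebra.
From mathcomp Require Import complex ring lra.
From mathcomp Require Import all_classical all_reals all_analysis.
From mathcomp Require Import measurable_realfun.

(** With [s = log r] and [v = u / sqrt r] the form becomes that of a Schrodinger operator on the
    line, [v_s^2 + lam v^2 + r^2 Q v^2] integrated in [ds], and [h dr = (r^2 Q_-)^k ds]. The shift
    [lam = alpha + 1/4] is Hardy's: [u'^2 = W^2 + u^2/(4 r^2) + (u^2/(2r))'] with [W = u' - u/(2r)].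
    The profile [F'] comes from the equality case. Equality in both the completed square and Young's
    inequality forces [v_s = +- sqrt lam M F'(v/M)], the first-order equation of the sech-type
    ground state rising from 0 to its maximum [M] and falling back; hence the change of sign at the
    maximum.

    An eigenfunction is known only through the closure of the graph, so no regularity or nodal count
    is available for it. All analysis is done on test functions, and negativity is carried over to
    them by a finite matrix whose definiteness is stable under small changes. The cuts depend on [h]
    alone, not on the function. The same points therefore serve the whole complex span, and the real
    and imaginary parts of one element, both vanishing there, are estimated separately as real
    functions. *)

(** Let [h(r) = r^(2k-1) Q_-(r)^k].  If [u] vanishes at the ends of an interval,
    put [v = u / sqrt r] and [M = max |v|].  Completing squares and using Young's
    inequality for [Q_- v^2],
      [-u''u + alpha u^2/r^2 + Q u^2 >= (d/dr) B - M^2 K h]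
    where [B] contains [+-2 sqrt(alpha + 1/4) M^2 F(v/M)] and
    [F'(t) = t sqrt(1 - |t|^(2/(k-1)))], with [K] the constant in Young's
    inequality.  Taking opposite signs on the two sides of the maximum of [|v|]
    shows that the form is nonnegative on every interval where [\int h <= T],
    [T = 4 sqrt(alpha + 1/4) (F 1 - F 0) / K].  By Euler's beta integral [1/T] is
    the constant in the bound.

    Given [n] independent eigenfunctions with negative eigenvalues, approximate
    them by test functions on whose span the form is still negative definite.  If
    [\int h < n T], then [n - 1] points would cut the support into intervals on
    which [\int h <= T], and a nonzero element of the span vanishing
    at these points would have nonnegative form. *)

Set Implicit Arguments.
Unset Strict Implicit.
Unset Printing Implicit Defensive.

Import Order.TTheory GRing.Theory Num.Theory.
Import numFieldNormedType.Exports.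

Local Open Scope classical_set_scope.
Local Open Scope ring_scope.


(** * The Gamma function *)

Lemma RposE (R : realType) (r : R) : Rpos r = (0 < r) :> Prop.
Proof. by rewrite /Rpos /= in_itv /= andbT. Qed.

Lemma mem_Rpos (R : realType) (r : R) : (r \in (Rpos : set R)) = (0 < r).
Proof. by apply/idP/idP; rewrite inE RposE. Qed.

Lemma measurable_Rpos (R : realType) : measurable (Rpos : set R).
Proof. exact: measurable_itv. Qed.
#[global] Hint Extern 0 (measurable Rpos) => apply: measurable_Rpos : core.

Section Gamma.
Context {R : realType}.
Notation mu := (@lebesgue_measure R).

Lemma is_derive_fun_powR (p x : R) : 0 < x ->
  is_derive x 1 (fun y : R => y `^ p) (p * x `^ (p - 1)).
Proof. exact: is_derive1_powR. Qed.

(** The absolute value matters: on negative bases [powR] is a default value and jumps at 0. With it,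
    the integrands below are continuous on the whole line, as the substitution rule on [[0, +oo[]
    wants. *)
Lemma continuous_normpowR (p : R) : 0 < p -> continuous (fun x : R => `|x| `^ p).
Proof.
move=> p0 x; have [->|x0] := eqVneq x 0.
  apply/cvgrPdist_lt => e e0; near=> y.
  rewrite normr0 powR0 ?gt_eqF// sub0r normrN ger0_norm ?powR_ge0//.
  have -> : e = (e `^ p^-1) `^ p by rewrite -powRrM mulVf ?gt_eqF// powRr1 ?ltW.
  apply: gt0_ltr_powR; rewrite ?nnegrE ?powR_ge0//.
  rewrite -[y]opprK normrN -[- y]add0r; near: y.
  by apply: cvgr_dist_lt; [exact: cvg_id | exact: powR_gt0].
apply: (@continuous_comp _ _ _ (fun y : R => `|y|) (fun y : R => y `^ p)).
  exact: norm_continuous.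
apply: differentiable_continuous; apply/derivable1_diffP.
by apply: derivable_powR; rewrite in_itv /= andbT normr_gt0.
Unshelve. all: by end_near. Qed.

Lemma integral_Rpos_cbnd (f : R -> R) : measurable_fun Rpos f ->
  (\int[mu]_(t in Rpos) (f t)%:E = \int[mu]_(t in `[0%R, +oo[) (f t)%:E)%E.
Proof.
by move=> mf; rewrite -integral_itv_obnd_cbnd//; apply/measurable_EFinP.
Qed.

Lemma integral_Rpos_scale (s : R) (g : R -> R) : 0 < s ->
  continuous g -> (forall x, 0 < x -> 0 <= g x) ->
  (\int[mu]_(t in Rpos) (g t)%:E = \int[mu]_(z in Rpos) (s * g (s * z))%:E)%E.
Proof.
move=> s0 cg g0.
have ds (x : R) : is_derive x 1 ( *%R s) s.
  by apply: is_derive_eq; rewrite /GRing.scale /= mulr1.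
have ds' : derive1 ( *%R s) = cst s.
  by apply/funext => x; rewrite derive1E derive_val.
rewrite integral_Rpos_cbnd; last first.
  by apply: measurable_funTS; exact: continuous_measurable_fun.
have cs : continuous (fun z => s * g (s * z)).
  move=> z; apply: cvgM; first exact: cvg_cst.
  by apply: (@continuous_comp _ _ _ ( *%R s)); [exact: mulrl_continuous|exact: cg].
rewrite integral_Rpos_cbnd; last first.
  by apply: measurable_funTS; exact: continuous_measurable_fun.
have := @increasing_ge0_integration_by_substitutiony R ( *%R s) g 0.
rewrite mulr0 ds' => ->.
- by apply: eq_integral => x _ /=; rewrite /GRing.mul /= mulrC.
- by move=> x y _ _; rewrite ltr_pM2l.
- by move=> x _; exact: cst_continuous.
- exact: is_cvg_cst.
- exact: is_cvg_cst.
- split => [x _|]; first exact: ex_derive.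
  exact/cvg_at_right_filter/mulrl_continuous.
- exact: gt0_cvgMry.
- exact: continuous_subspaceT.
- by move=> x; rewrite in_itv /= andbT; exact: g0.
Qed.
End Gamma.

(** * Euler's beta integral *)

Section GammaSquare.
Context {R : realType}.
Notation mu := (@lebesgue_measure R).

Let integral2_Rpos (h : R -> R -> R) :
  (\int[mu]_(s in Rpos) \int[mu]_(z in Rpos) (h s z)%:E =
   \int[mu]_s \int[mu]_z (\1_Rpos s * \1_Rpos z * h s z)%:E)%E.
Proof.
rewrite [LHS]integral_mkcond; apply: eq_integral => s _.
rewrite patchE !indicE; case: ifPn => [_|_]; last first.
  by rewrite integral0_eq// => z _; rewrite !mul0r.
rewrite [LHS]integral_mkcond; apply: eq_integral => z _.
by rewrite patchE indicE; case: ifPn => _; rewrite mul1r ?mul1r ?mul0r.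
Qed.

(** Multiplying by indicators extends [h] by zero to the plane, so Tonelli applies although the sign
    of [h] is known only on the quadrant. *)
Lemma tonelli_Rpos (h : R -> R -> R) :
  measurable_fun setT (fun p : measurableTypeR R * measurableTypeR R => h p.1 p.2) ->
  (forall s z, 0 < s -> 0 < z -> 0 <= h s z) ->
  (\int[mu]_(s in Rpos) \int[mu]_(z in Rpos) (h s z)%:E =
   \int[mu]_(z in Rpos) \int[mu]_(s in Rpos) (h s z)%:E)%E.
Proof.
move=> mh h0; rewrite integral2_Rpos (integral2_Rpos (fun z s => h s z)).
pose H (p : measurableTypeR R * measurableTypeR R) :=
  (\1_Rpos p.1 * \1_Rpos p.2 * h p.1 p.2)%:E.
have mH : measurable_fun setT H.
  apply/measurable_EFinP; apply: measurable_funM => //; apply: measurable_funM.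
    by apply: (measurableT_comp (f := \1_Rpos : measurableTypeR R -> R)) => //;
      exact: measurable_indic.
  have m1 : measurable_fun setT (\1_Rpos : measurableTypeR R -> R).
    exact: measurable_indic.
  exact: (measurableT_comp m1).
have H0 p : (0 <= H p)%E.
  rewrite /H lee_fin !indicE !mem_Rpos.
  by case: ltP => s0; case: ltP => z0; rewrite !(mul1r, mul0r)// h0.
have := @fubini_tonelli _ _ _ _ R mu mu H mH H0; rewrite /H /= => ->.
by under eq_integral do under eq_integral do rewrite [_ * \1_Rpos _]mulrC.
Qed.

(** Applying [ln y <= y] to [y = t / (2 (x - 1))] gives [t^(x-1) e^(-t/2) <= C]. The integrand is
    thus at most [C e^(-t/2)], which is [2 C] times the exponential density of rate 1/2. *)
Lemma integrable_Gamma (x : R) : 1 < x ->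
  mu.-integrable Rpos (fun t => (t `^ (x - 1) * expR (- t))%:E).
Proof.
move=> x1; have p0 : 0 < x - 1 by rewrite subr_gt0.
pose C := (2 * (x - 1)) `^ (x - 1).
have ipdf : mu.-integrable Rpos (fun t => (2 * C)%:E * (exponential_pdf 2^-1 t)%:E)%E.
  apply: integrableZl => //.
  by apply: (integrableS (E := setT)) => //; apply: integrable_exponential_pdf.
apply: (le_integrable _ _ _ ipdf) => //.
  apply/measurable_EFinP; apply: measurable_funTS; apply: measurable_funM => //.
  by apply: measurableT_comp.
move=> t; rewrite RposE => t0; rewrite -EFinM !abse_EFin lee_fin ger0_norm; last first.
  by rewrite mulr_ge0 ?powR_ge0 ?expR_ge0.
apply: le_trans (ler_norm _).
rewrite (exponential_pdfE _ (ltW t0)) mulrACA divff// mul1r.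
rewrite /C /powR !gt_eqF ?mulr_gt0// -!expRD ler_expR.
have := ln_sublinear (divr_gt0 t0 (mulr_gt0 (ltr0n _ 2) p0)).
rewrite ln_div ?posrE ?mulr_gt0// => h.
have : (x - 1) * (ln t - ln (2 * (x - 1))) <= t / 2.
  rewrite -ler_pdivlMl//; apply: le_trans (ltW h) _; rewrite invfM.
  by rewrite [leRHS]mulrC -mulrA.
by rewrite mulrBr; lra.
Qed.

Lemma EFin_Gamma (x : R) : 1 < x ->
  (Gamma x)%:E = (\int[mu]_(t in Rpos) (t `^ (x - 1) * expR (- t))%:E)%E.
Proof.
move=> x1; rewrite /Gamma /Rintegral fineK//.
by apply: integrable_fin_num => //; exact: integrable_Gamma.
Qed.

(** On [[1, 2]] the integrand is at least [e^(-2)]. *)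
Lemma Gamma_gt0 (x : R) : 1 < x -> 0 < Gamma x.
Proof.
move=> x1; rewrite -lte_fin EFin_Gamma//.
have D : `[1%R, 2%R]%classic `<=` (Rpos : set R).
  by move=> t; rewrite RposE /= in_itv /= => /andP[+ _]; exact: lt_le_trans.
have mf : measurable_fun Rpos (fun t : R => t `^ (x - 1) * expR (- t)).
  apply: measurable_funTS; apply: measurable_funM => //.
  by apply: measurableT_comp.
have f0 (t : R) : (0 <= (t `^ (x - 1) * expR (- t))%:E)%E.
  by rewrite lee_fin mulr_ge0 ?powR_ge0 ?expR_ge0.
suff h : (0 < \int[mu]_(t in `[1%R, 2%R]) (t `^ (x - 1) * expR (- t))%:E)%E.
  apply: lt_le_trans h _; apply: ge0_subset_integral => //.
  exact/measurable_EFinP.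
apply: (@lt_le_trans _ _ (\int[mu]_(t in `[1%R, 2%R]) (expR (- 2))%:E)%E).
  rewrite integral_cst//= lebesgue_measure_itv /= lte_fin ltr1n/=.
  by rewrite -EFinB -EFinM lte_fin mulr_gt0 ?expR_gt0//; lra.
apply: ge0_le_integral => //.
- by apply/measurable_EFinP; exact: measurable_funS mf.
move=> t; rewrite /= in_itv /= => /andP[t1 t2].
rewrite lee_fin -[leLHS]mul1r ler_pM ?expR_ge0 ?ler_expR ?lerN2//.
rewrite -[leLHS](powRr0 t) ler_powR//; lra.
Qed.

(** This is [B(k, k) = Gamma(k)^2 / Gamma(2k)], the beta function being written over the half-line.
    In the product of two Gamma integrals the second variable is replaced by [s z], which produces
    the kernel [h s z]; after Tonelli, the integral in [s] is [Gamma (2k)] rescaled by [1 + z]. *)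
Lemma Gamma_sqr (k : R) : 1 < k ->
  ((Gamma k ^+ 2)%:E = (Gamma (2 * k))%:E *
    \int[mu]_(z in Rpos) (z `^ (k - 1) * (1 + z) `^ (- (2 * k)))%:E)%E.
Proof.
move=> k1.
pose g (x t : R) := `|t| `^ (x - 1) * expR (- t).
have cg x : 1 < x -> continuous (g x).
  move=> x1 t; apply: cvgM; first by apply: continuous_normpowR; rewrite subr_gt0.
  by apply: continuous_comp; [exact: continuousN|exact: continuous_expR].
have g0 x t : 0 <= g x t by rewrite mulr_ge0 ?powR_ge0 ?expR_ge0.
have GE x : 1 < x -> (Gamma x)%:E = (\int[mu]_(t in Rpos) (g x t)%:E)%E.
  move=> x1; rewrite (EFin_Gamma x1); apply: eq_integral => t.
  by rewrite mem_Rpos => t0; rewrite /g gtr0_norm.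
pose h (s z : R) := `|s| `^ (2 * k - 1) * `|z| `^ (k - 1) * expR (- (s * (1 + z))).
have h0 s z : 0 <= h s z by rewrite !mulr_ge0 ?powR_ge0 ?expR_ge0.
have mg x : 1 < x -> measurable_fun Rpos (fun t => (g x t)%:E).
  by move=> x1; apply/measurable_EFinP; apply: measurable_funTS;
    apply: continuous_measurable_fun; exact: cg.
transitivity (\int[mu]_(s in Rpos) \int[mu]_(z in Rpos) (h s z)%:E)%E.
  rewrite expr2 EFinM {1}GE// -ge0_integralZr//; last 3 first.
  - exact: mg.
  - by move=> t _; rewrite lee_fin.
  - by rewrite lee_fin ltW// Gamma_gt0.
  apply: eq_integral => s; rewrite mem_Rpos => s0.
  rewrite GE// (integral_Rpos_scale s0)//; last exact: cg.
  rewrite -ge0_integralZl//; last 3 first.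
  - apply/measurable_EFinP; apply: measurable_funTS.
    apply: continuous_measurable_fun => z; apply: cvgM; first exact: cvg_cst.
    apply: (@continuous_comp _ _ _ ( *%R s)); first exact: mulrl_continuous.
    exact: cg.
  - by move=> t _; rewrite lee_fin mulr_ge0 ?(ltW s0).
  - by rewrite lee_fin.
  apply: eq_integral => z; rewrite mem_Rpos => z0; rewrite -EFinM; congr EFin.
  rewrite /g /h normrM !gtr0_norm//.
  rewrite powRM ?ltW// mulrDr mulr1 opprD expRD.
  have -> : 2 * k - 1 = (k - 1) + (1 + (k - 1)) by ring.
  have sD u v : s `^ (u + v) = s `^ u * s `^ v by rewrite powRD// (gt_eqF s0) implybT.
  rewrite (sD (k - 1)) (sD 1).
  by rewrite (powRr1 (ltW s0)); ring.
rewrite tonelli_Rpos; last 2 first.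
- apply: measurable_funM; first apply: measurable_funM.
  + apply: (measurableT_comp (f := fun s : measurableTypeR R => `|s| `^ (2 * k - 1))) => //.
    by apply: continuous_measurable_fun; apply: continuous_normpowR; lra.
  + apply: (measurableT_comp (f := fun s : measurableTypeR R => `|s| `^ (k - 1))) => //.
    by apply: continuous_measurable_fun; apply: continuous_normpowR; lra.
  apply: measurableT_comp => //; apply: measurableT_comp => //.
  apply: measurable_funM => //; exact: measurable_funD.
- by move=> s z _ _.
rewrite -ge0_integralZl//; last 3 first.
- apply/measurable_EFinP; apply: measurable_funTS; apply: measurable_funM => //.
  apply: (measurableT_comp (f := fun y : measurableTypeR R => y `^ (- (2 * k)))) => //.
  exact: measurable_funD.
- by move=> t _; rewrite lee_fin mulr_ge0 ?powR_ge0.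
- by rewrite lee_fin ltW// Gamma_gt0//; lra.
apply: eq_integral => z; rewrite mem_Rpos => z0.
have z1 : 0 < 1 + z by rewrite addr_gt0.
have k2 : 1 < 2 * k by lra.
rewrite (GE _ k2) (integral_Rpos_scale z1 (cg _ k2))//.
rewrite -ge0_integralZr//; last 3 first.
- apply/measurable_EFinP; apply: measurable_funTS.
  apply: continuous_measurable_fun => s; apply: cvgM; first exact: cvg_cst.
  apply: (@continuous_comp _ _ _ ( *%R (1 + z))); first exact: mulrl_continuous.
  exact: cg.
- by move=> t _; rewrite lee_fin mulr_ge0 ?(ltW z1).
- by rewrite lee_fin mulr_ge0 ?powR_ge0.
apply: eq_integral => s; rewrite mem_Rpos => s0; rewrite -EFinM; congr EFin.
rewrite /h /g normrM !gtr0_norm// powRM ?ltW// powRN.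
rewrite -[(1 + z) `^ (2 * k)]mulr_powRB1 ?ltW//; last lra.
have := powR_gt0 (2 * k - 1) z1; set u := _ `^ _ => u0.
by rewrite [s * _]mulrC; field; rewrite !gt_eqF.
Qed.
End GammaSquare.

(** * The extremal profile *)

Section Derivatives.
Context {R : realType}.
Implicit Types f g : R -> R.

Lemma is_derive_addf f g (x df dg : R) : is_derive x 1 f df -> is_derive x 1 g dg ->
  is_derive x 1 (fun y => f y + g y) (df + dg).
Proof. exact: is_deriveD. Qed.

Lemma is_derive_oppf f (x df : R) : is_derive x 1 f df ->
  is_derive x 1 (fun y => - f y) (- df).
Proof. exact: is_deriveN. Qed.

Lemma is_derive_subf f g (x df dg : R) : is_derive x 1 f df -> is_derive x 1 g dg ->
  is_derive x 1 (fun y => f y - g y) (df - dg).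
Proof. exact: is_deriveB. Qed.

Lemma is_derive_mulf f g (x df dg : R) : is_derive x 1 f df -> is_derive x 1 g dg ->
  is_derive x 1 (fun y => f y * g y) (df * g x + f x * dg).
Proof.
move=> hf hg; apply: is_derive_eq (is_deriveM hf hg) _.
by rewrite /GRing.scale /= addrC [g x * _]mulrC.
Qed.

Lemma is_derive_scalef (c : R) f (x df : R) : is_derive x 1 f df ->
  is_derive x 1 (fun y => c * f y) (c * df).
Proof. exact: is_deriveZ. Qed.

Lemma is_derive_compf f g (x dg df : R) : is_derive (f x) 1 g dg -> is_derive x 1 f df ->
  is_derive x 1 (fun y => g (f y)) (dg * df).
Proof. exact: is_derive1_comp. Qed.

Lemma is_derive_invf f (x df : R) : f x != 0 -> is_derive x 1 f df ->
  is_derive x 1 (fun y => (f y)^-1) (- df / f x ^+ 2).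
Proof.
move=> fx hf; apply: is_derive_eq (is_deriveV fx hf) _.
by rewrite /GRing.scale /= !mulNr mulrC.
Qed.

Lemma is_derive_continuous f (x df : R) : is_derive x 1 f df -> {for x, continuous f}.
Proof. by case=> h _; apply: differentiable_continuous; exact/derivable1_diffP. Qed.

Lemma is_derive_derive1 f (x df : R) : is_derive x 1 f df -> derive1 f x = df.
Proof. by case=> _ <-; rewrite derive1E. Qed.

Lemma near_is_derive f g (x df : R) : (\forall y \near x, f y = g y) ->
  is_derive x 1 f df -> is_derive x 1 g df.
Proof. exact: near_eq_is_derive. Qed.

Lemma integral_FTC f F (a b : R) : a < b ->
  (forall x, a <= x <= b -> {for x, continuous f}) ->
  (forall x, a <= x <= b -> {for x, continuous F}) ->
  (forall x, a < x < b -> is_derive x 1 F (f x)) ->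
  (\int[lebesgue_measure]_(x in `[a, b]) (f x)%:E = (F b - F a)%:E)%E.
Proof.
move=> ab cf cF dF; rewrite EFinB; apply: continuous_FTC2 => //.
- apply: continuous_in_subspaceT => x; rewrite inE /= in_itv /=; exact: cf.
- split=> [x||].
  + by rewrite in_itv /= => /dF [].
  + by apply/cvg_at_right_filter/cF; rewrite lexx ltW.
  + by apply/cvg_at_left_filter/cF; rewrite lexx ltW.
- by move=> x; rewrite in_itv /= => /dF; exact: is_derive_derive1.
Qed.

Lemma continuous_primitive f (a b : R) : continuous f -> a < b ->
  exists F : R -> R, forall x, a < x < b -> is_derive x 1 F (f x).
Proof.
move=> cf ab.
pose F x : R := \int[lebesgue_measure]_(t in `[a, x]) f t.
exists F => x /andP[ax xb].
have /(continuous_FTC1_closed xb) : lebesgue_measure.-integrable `[a, b] (EFin \o f).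
  apply: continuous_compact_integrable; first exact: segment_compact.
  exact: continuous_subspaceT.
move=> /(_ ax (cf x)) [dF <-].
by apply: (DeriveDef dF); rewrite derive1E.
Qed.
End Derivatives.

Section Soliton.
Context {R : realType}.
Notation mu := (@lebesgue_measure R).

(** Phase-plane profile of the extremal: its square is [t^2 - |t|^(2k/(k-1))] for [|t| <= 1], the
    energy relation of a ground state with maximum 1. For [|t| > 1] the square root is 0 by
    convention, so the function is continuous on the line. *)
Definition soliton (k t : R) : R := t * Num.sqrt (1 - `|t| `^ (2 / (k - 1))).

Lemma soliton_continuous (k : R) : 1 < k -> continuous (soliton k).
Proof.
move=> k1 t; apply: cvgM; first exact: cvg_id.
apply: continuous_comp; last exact: sqrt_continuous.
apply: cvgB; first exact: cvg_cst.
by apply: continuous_normpowR; rewrite divr_gt0// subr_gt0.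
Qed.

(* Substituting [w = 1/(1+z)] and then [t = (4w(1-w))^((k-1)/2)] turns the
   square root in [soliton] into [|2w - 1|]; an integration by parts, with
   boundary term [(2w-1)(4w(1-w))^(k-1)/2], leaves the beta integral. *)
Lemma soliton_mass (k : R) (F : R -> R) : 3 / 2 <= k ->
  (forall t : R, -2 < t < 2 -> is_derive t 1 F (soliton k t)) ->
  (\int[mu]_(z in Rpos) (z `^ (k - 1) * (1 + z) `^ (- (2 * k)))%:E =
   (2 * 4 `^ (1 - k) * (F 1 - F 0))%:E)%E.
Proof.
move=> hk dF.
pose p := k - 1; have p0 : 0 < p by rewrite /p; lra.
have p20 : 0 < p / 2 by rewrite divr_gt0.
pose w (z : R) : R := (1 + z)^-1.
pose P (x : R) : R := 4 * (x * (1 - x)).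
(* When [e] is the sign of [2 x - 1], [K e] is a primitive of [- P^p]. Since [w' = - w^2], the
   composite [K e \o w] is then a primitive of [D], which is the integrand up to the factor
   [4^(1-k)]. *)
pose K (e x : R) : R := e * F (`|P x| `^ (p / 2)) - 2^-1 * ((2 * x - 1) * `|P x| `^ p).
pose D (z : R) : R := w z ^+ 2 * `|P (w z)| `^ p.
have cP : continuous P.
  move=> x; apply: cvgM; first exact: cvg_cst.
  by apply: cvgM; [exact: cvg_id|apply: cvgB; [exact: cvg_cst|exact: cvg_id]].
have P01 (x : R) : 0 <= x <= 1 -> 0 <= P x <= 1.
  move=> /andP[x0 x1]; rewrite /P; apply/andP; split.
    by rewrite mulr_ge0// mulr_ge0// subr_ge0.
  by rewrite -subr_ge0 (_ : _ - _ = (2 * x - 1) ^+ 2) ?sqr_ge0//; ring.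
have T01 (x : R) : 0 <= x <= 1 -> -2 < `|P x| `^ (p / 2) < 2.
  move=> /P01/andP[P0 P1]; rewrite ger0_norm//.
  have := powR_ge0 (P x) (p / 2).
  have e1 : 1 `^ (p / 2) = 1 :> R by rewrite powR1.
  have : P x `^ (p / 2) <= 1 by rewrite -[leRHS]e1 ge0_ler_powR ?nnegrE// ltW.
  lra.
have cPp (q : R) : 0 < q -> continuous (fun x => `|P x| `^ q).
  move=> q0 x; apply: (@continuous_comp _ _ _ P (fun y => `|y| `^ q)); first exact: cP.
  exact: continuous_normpowR.
have cK (e x : R) : 0 <= x <= 1 -> {for x, continuous (K e)}.
  move=> x01; apply: cvgB; apply: cvgM; try exact: cvg_cst.
    apply: (@continuous_comp _ _ _ (fun y => `|P y| `^ (p / 2))); first exact: cPp.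
    exact: is_derive_continuous (dF _ (T01 _ x01)).
  apply: cvgM; last exact: cPp.
  by apply: cvgB; [apply: cvgM; [exact: cvg_cst|exact: cvg_id]|exact: cvg_cst].
have w01 (z : R) : 0 <= z -> 0 < w z <= 1.
  move=> z0; have z1 : 0 < 1 + z by lra.
  by rewrite /w invr_gt0 invf_le1// lerDl z0 z1.
have dw (z : R) : 0 <= z -> is_derive z 1 w (- w z ^+ 2).
  move=> z0.
  have h := is_derive_addf (is_derive_cst (1 : R) z (1 : R)) (is_derive_id z (1 : R)).
  apply: is_derive_eq (is_derive_invf _ h) _; first by rewrite /= gt_eqF// ltr_pwDl.
  by rewrite add0r mulN1r /w exprVn.
have cw (z : R) : 0 <= z -> {for z, continuous w}.
  by move=> /dw; exact: is_derive_continuous.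
have cKw (e z : R) : 0 <= z -> {for z, continuous (K e \o w)}.
  move=> z0; apply: continuous_comp; first exact: cw.
  by apply: cK; have /andP[/ltW-> ->] := w01 z z0.
have cD (z : R) : 0 <= z -> {for z, continuous D}.
  move=> z0; apply: (@continuous_comp _ _ _ w (fun y => y ^+ 2 * `|P y| `^ p)).
    exact: cw.
  by apply: cvgM; [exact: exprn_continuous|exact: cPp].
have D0 (z : R) : 0 <= D z by rewrite mulr_ge0 ?sqr_ge0 ?powR_ge0.
have dKw (e z : R) : 0 < z -> e * `|2 * w z - 1| = 2 * w z - 1 -> z != 1 ->
    is_derive z 1 (K e \o w) (D z).
  move=> z0 he z1; set x := w z.
  have /andP[x0 _] := w01 _ (ltW z0); rewrite -/x in he x0.
  have x1 : x < 1 by rewrite /x /w invf_lt1 ?ltrDl ?ltr_pwDl// ltW.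
  have Px : 0 < P x by rewrite /P !mulr_gt0 ?subr_gt0.
  have dP : is_derive x 1 P (4 * (1 - 2 * x)).
    apply: is_derive_scalef.
    have h := is_derive_subf (is_derive_cst (1 : R) x (1 : R)) (is_derive_id x (1 : R)).
    apply: is_derive_eq (is_derive_mulf (is_derive_id x 1) h) _ => /=.
    by ring.
  have dPq (q : R) : is_derive x 1 (fun y => `|P y| `^ q) (q * P x `^ (q - 1) * (4 * (1 - 2 * x))).
    apply: (@near_is_derive _ (fun y => P y `^ q)).
      have : \forall y \near x, 0 < P y by exact: cvgr_gt (cP x) _ Px.
      by apply: filterS => y y0; rewrite gtr0_norm.
    exact: (@is_derive_compf _ P (fun y => y `^ q) _ _ _ (is_derive_fun_powR q Px) dP).
  have x01 : 0 <= x <= 1 by rewrite !ltW.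
  have dFT := @is_derive_compf _ (fun y => `|P y| `^ (p / 2)) F _ _ _
    (dF _ (T01 _ x01)) (dPq (p / 2)).
  have dl := is_derive_subf (is_derive_scalef 2 (is_derive_id x (1 : R)))
    (is_derive_cst (1 : R) x (1 : R)).
  have dK : is_derive x 1 (K e) (- P x `^ p).
    apply: is_derive_eq (is_derive_subf (is_derive_scalef e dFT)
      (is_derive_scalef 2^-1 (is_derive_mulf dl (dPq p)))) _.
    rewrite /soliton -/p (gtr0_norm Px) ger0_norm ?powR_ge0// -powRrM.
    rewrite (_ : p / 2 * (2 / p) = 1); last by field; rewrite gt_eqF.
    rewrite powRr1 ?ltW// (_ : 1 - P x = (2 * x - 1) ^+ 2); last by rewrite /P; ring.
    rewrite sqrtr_sqr.
    have -> : P x `^ (p - 1) = P x `^ (p / 2) * P x `^ (p / 2 - 1).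
      by rewrite -powRD ?(gt_eqF Px) ?implybT//; congr (_ `^ _); field.
    transitivity ((e * `|2 * x - 1|) * (P x `^ (p / 2) * P x `^ (p / 2 - 1)) * (2 * p) * (1 - 2 * x) -
       P x `^ p - 2^-1 * (2 * x - 1) * (p * (P x `^ (p / 2) * P x `^ (p / 2 - 1)) * (4 * (1 - 2 * x)))).
      by rewrite /cst; field.
    by rewrite he; field.
  apply: is_derive_eq (is_derive_compf dK (dw _ (ltW z0))) _.
  by rewrite /D -/x (gtr0_norm Px); ring.
have DE (z : R) : 0 < z -> z `^ (k - 1) * (1 + z) `^ (- (2 * k)) = 4 `^ (1 - k) * D z.
  move=> z0; have z1 : 0 < 1 + z by rewrite addr_gt0.
  have PE : P (w z) = 4 * z * w z ^+ 2 by rewrite /P /w; field; rewrite gt_eqF.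
  have wz : 0 < w z by rewrite invr_gt0.
  rewrite /D PE gtr0_norm ?mulr_gt0// powRM ?mulr_ge0 ?ltW// powRM ?ltW//.
  rewrite -(powR_mulrn 2 (ltW wz)) -powRrM.
  have e1 : w z `^ 2%:R * w z `^ (2%:R * p) = w z `^ (2 * k).
    by rewrite -powRD ?(gt_eqF wz) ?implybT//; congr (_ `^ _); rewrite /p; ring.
  have e2 : w z `^ (2 * k) = (1 + z) `^ (- (2 * k)).
    by rewrite /w -powR_inv1 ?ltW// -powRrM mulN1r.
  have e3 : 4 `^ (1 - k) * 4 `^ p = 1 :> R.
    by rewrite -powRD ?pnatr_eq0 ?implybT// /p (_ : _ + _ = 0) ?powRr0//; ring.
  rewrite -e2 -e1 [4 `^ _ * (_ * _)]mulrCA; rewrite -/p.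
  transitivity ((4 `^ (1 - k) * 4 `^ p) * (z `^ p * (w z `^ 2%:R * w z `^ (2%:R * p)))).
    by rewrite e3 mul1r.
  by ring.
have w0 : w 0 = 1 by rewrite /w addr0 invr1.
have w1 : w 1 = 2^-1 by [].
have K0 (e : R) : K e 0 = e * F 0.
  by rewrite /K /P mul0r mulr0 normr0 !powR0 ?gt_eqF// !mulr0 subr0.
have K1 (e : R) : K e 1 = e * F 0.
  by rewrite /K /P subrr !mulr0 normr0 !powR0 ?gt_eqF// !mulr0 subr0.
have K2 (e : R) : K e 2^-1 = e * F 1.
  rewrite /K /P (_ : 4 * _ = 1); last by field.
  by rewrite divff// subrr mul0r mulr0 subr0 normr1 powR1.
(* The sign of [2 w - 1] changes at [z = 1], where [w = 1/2]. The integral is cut there, with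
   [e = 1] before and [e = -1] after; the two halves are equal, whence the factor 2 in the
   statement. *)
have I1 : (\int[mu]_(z in `[0%R, 1%R]) (D z)%:E = (F 1 - F 0)%:E)%E.
  transitivity ((K 1 \o w) 1 - (K 1 \o w) 0)%:E.
    apply: integral_FTC => [|z|z|z]; first exact: ltr01.
    - by move=> /andP[z0 _]; exact: cD.
    - by move=> /andP[z0 _]; exact: cKw.
    - move=> /andP[z0 z1]; apply: dKw => //; last by rewrite lt_eqF.
      rewrite mul1r ger0_norm// subr_ge0 /w ler_pdivlMr ?mul1r; lra.
  by rewrite /= w0 w1 K1 K2 !mul1r.
have wy : w z @[z --> +oo] --> 0.
  apply/gtr0_cvgV0; last exact: cvg_addrl.
  by near=> z; rewrite ltr_pwDl.
have I2 : (\int[mu]_(z in `[1%R, +oo[) (D z)%:E = (F 1 - F 0)%:E)%E.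
  rewrite (@ge0_continuous_FTC2y _ D (K (-1) \o w) 1 (K (-1) 0)).
  - by rewrite /= w1 K0 K2 -EFinB; congr EFin; ring.
  - by move=> z _; exact: D0.
  - apply: continuous_in_subspaceT => z; rewrite inE /= in_itv /= andbT => z1.
    by apply: cD; lra.
  - by apply: continuous_cvg wy; apply: cK; rewrite lexx ler01.
  - move=> z z1; have z0 : 0 < z by lra.
    have he : -1 * `|2 * w z - 1| = 2 * w z - 1.
      rewrite ler0_norm ?mulN1r ?opprK// subr_le0 /w ler_pdivrMr ?mul1r; lra.
    by have [] := dKw (-1) z z0 he (negbT (gt_eqF z1)).
  - by apply/cvg_at_right_filter; apply: cKw; exact: ler01.
  - move=> z; rewrite in_itv /= andbT => z1; have z0 : 0 < z by lra.
    have he : -1 * `|2 * w z - 1| = 2 * w z - 1.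
      rewrite ler0_norm ?mulN1r ?opprK// subr_le0 /w ler_pdivrMr ?mul1r; lra.
    exact: is_derive_derive1 (dKw (-1) z z0 he (negbT (gt_eqF z1))).
have mD : measurable_fun Rpos D.
  apply: open_continuous_measurable_fun; first exact: interval_open.
  by move=> z; rewrite mem_Rpos => /ltW; exact: cD.
transitivity (\int[mu]_(z in Rpos) ((4 `^ (1 - k))%:E * (D z)%:E))%E.
  by apply: eq_integral => z; rewrite mem_Rpos => z0; rewrite DE.
rewrite ge0_integralZl ?lee_fin ?powR_ge0//; last 2 first.
- exact/measurable_EFinP.
- by move=> z _; rewrite lee_fin.
have -> : (\int[mu]_(z in Rpos) (D z)%:E = (F 1 - F 0)%:E + (F 1 - F 0)%:E)%E.
  rewrite -{1}I1 -I2.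
  have E : (Rpos : set R) = `]0, 1[ `|` `[1, +oo[.
    apply/seteqP; split=> z; rewrite RposE /= !in_itv /= ?andbT.
      by move=> z0; case: (ltP z 1) => z1; [left; rewrite z0|right].
    by case=> [/andP[]//|]; exact: lt_le_trans.
  rewrite E ge0_integral_setU//=; last 3 first.
  - by rewrite -E; exact/measurable_EFinP.
  - by move=> z _; rewrite lee_fin.
  - apply/disj_setPS => z [] /=; rewrite !in_itv /= andbT => /andP[_ z1].
    by rewrite leNgt z1.
  congr (_ + _)%E.
  rewrite integral_itv_bndo_bndc; last first.
    apply/measurable_EFinP; apply: measurable_funS mD => // z /=.
    by rewrite in_itv /= RposE => /andP[].
  rewrite integral_itv_obnd_cbnd//.
  apply/measurable_EFinP; apply: measurable_funS mD => // z /=.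
  by rewrite in_itv /= RposE => /andP[].
by rewrite -EFinD -EFinM; congr EFin; ring.
Unshelve. all: by end_near. Qed.
End Soliton.

(** * The form on an interval *)

Section Pointwise.
Context {R : realType}.
Implicit Types k lam y A : R.

(** The maximum over [y >= 0] of [y - lam y^(k/(k-1))], hence the best constant in [young_power]. *)
Definition young_const k lam : R := (k - 1) `^ (k - 1) / (k `^ k * lam `^ (k - 1)).

Lemma young_const_gt0 k lam : 1 < k -> 0 < lam -> 0 < young_const k lam.
Proof.
move=> k1 l0; rewrite divr_gt0 ?mulr_gt0 ?powR_gt0//; lra.
Qed.

Lemma young_power k lam y A : 1 < k -> 0 < lam -> 0 <= y -> 0 <= A ->
  A * y <= young_const k lam * A `^ k + lam * y `^ (k / (k - 1)).
Proof.
move=> k1 l0 y0 A0; have k0 : 0 < k by lra.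
have k10 : 0 < k - 1 by lra.
pose q := k / (k - 1); have q0 : 0 < q by rewrite divr_gt0.
(* Young is applied to the factors [A / s^(1/q)] and [s^(1/q) y]. The weight [s = q lam] makes the
   second term [s y^q / q] exactly [lam y^q]. *)
pose s := q * lam; have s0 : 0 < s by rewrite mulr_gt0.
have hs : s `^ q^-1 != 0 by rewrite gt_eqF// powR_gt0.
have a0 : 0 <= A / s `^ q^-1 by rewrite divr_ge0 ?powR_ge0.
have b0 : 0 <= s `^ q^-1 * y by rewrite mulr_ge0 ?powR_ge0.
have kq : k^-1 + q^-1 = 1 by rewrite /q; field; rewrite !gt_eqF.
have := conjugate_powR a0 b0 k0 q0 kq.
have -> : A / s `^ q^-1 * (s `^ q^-1 * y) = A * y by field.
move=> /le_trans; apply; apply: lerD; last first.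
  rewrite powRM ?powR_ge0// -powRrM mulVf ?gt_eqF// (powRr1 (ltW s0)) /s.
  by rewrite le_eqVlt; apply/orP; left; apply/eqP; field; rewrite gt_eqF.
rewrite powRM ?invr_ge0 ?powR_ge0// -(powR_inv1 (powR_ge0 _ _)) -!powRrM.
have -> : q^-1 * (-1 * k) = - (k - 1) by rewrite /q; field; rewrite !gt_eqF.
rewrite powRN /young_const.
have -> : s `^ (k - 1) = k `^ (k - 1) / (k - 1) `^ (k - 1) * lam `^ (k - 1).
  rewrite /s /q powRM ?ltW// powRM ?ltW ?invr_gt0//.
  by rewrite -(powR_inv1 (ltW k10)) -powRrM mulN1r powRN.
rewrite -[k `^ k](mulr_powRB1 (ltW k0) k0).
rewrite le_eqVlt; apply/orP; left; apply/eqP; field.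
by rewrite !gt_eqF ?powR_gt0.
Qed.

(** Written in powers of [t^2] so that the last term is the one in [young_power] at [y = t^2]. *)
Lemma soliton_sqr k (t : R) : 1 < k -> `|t| <= 1 ->
  soliton k t ^+ 2 = t ^+ 2 - (t ^+ 2) `^ (k / (k - 1)).
Proof.
move=> k1 t1; have k10 : 0 < k - 1 by lra.
have e1 : `|t| `^ (2 / (k - 1)) = (t ^+ 2) `^ (k - 1)^-1.
  by rewrite powRrM powR_mulrn// real_normK ?num_real.
have e2 : k / (k - 1) = 1 + (k - 1)^-1 by field; rewrite gt_eqF.
have le1 : (t ^+ 2) `^ (k - 1)^-1 <= 1.
  have e3 : 1 `^ (k - 1)^-1 = 1 :> R by rewrite powR1.
  rewrite -[leRHS]e3 ge0_ler_powR ?nnegrE ?invr_ge0 ?(ltW k10) ?sqr_ge0//.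
  by rewrite -real_normK ?num_real// expr_le1.
rewrite /soliton exprMn e1 sqr_sqrtr ?subr_ge0// mulrBr mulr1 e2.
have [->|t0] := eqVneq t 0.
  by rewrite expr0n /= !mul0r powR0 ?subr0// gt_eqF// addr_gt0 ?invr_gt0.
rewrite powRD; last by rewrite sqrf_eq0 t0 implybT.
by rewrite powRr1 ?sqr_ge0.
Qed.

(* Here [W = u' - u/(2r)] and [t = v/M], where [v = u / sqrt r] and [M] is its
   maximum; the square completed is [(W - e sqrt lam M soliton(t) / sqrt r)^2]. *)
Lemma radial_pointwise k lam (r u W M Q Qm e t : R) :
  1 < k -> 0 < lam -> 0 < r -> 0 <= Qm -> - Qm <= Q -> `|t| <= 1 -> e ^+ 2 = 1 ->
  u = t * M * Num.sqrt r ->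
  e * (2 * Num.sqrt lam * M * soliton k t * (W / Num.sqrt r)) -
    M ^+ 2 * (young_const k lam * (r `^ (2 * k - 1) * Qm `^ k)) <=
  W ^+ 2 + lam * (u ^+ 2 / r ^+ 2) + Q * u ^+ 2.
Proof.
move=> k1 l0 r0 Qm0 QQ t1 e1 ->.
pose S := soliton k t; rewrite -/S.
have sr : 0 < Num.sqrt r by rewrite sqrtr_gt0.
have sr2 : Num.sqrt r ^+ 2 = r by rewrite sqr_sqrtr ?ltW.
have sl2 : Num.sqrt lam ^+ 2 = lam by rewrite sqr_sqrtr ?ltW.
have S2 : S ^+ 2 = t ^+ 2 - (t ^+ 2) `^ (k / (k - 1)) by exact: soliton_sqr.
(* Here [A = r^2 Qm]. Its [k]-th power is [r] times [r^(2k-1) Qm^k], and after the division by [r]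
   in [Y'] this leaves the weight of the theorem. *)
have := young_power k1 l0 (sqr_ge0 t) (mulr_ge0 (sqr_ge0 r) Qm0).
have -> : (t ^+ 2) `^ (k / (k - 1)) = t ^+ 2 - S ^+ 2 by rewrite S2; ring.
have -> : (r ^+ 2 * Qm) `^ k = r * (r `^ (2 * k - 1) * Qm `^ k).
  rewrite powRM ?sqr_ge0// -(powR_mulrn 2 (ltW r0)) -powRrM mulrA.
  by rewrite mulr_powRB1 ?ltW//; lra.
set h := r `^ _ * _; set K := young_const k lam => Y.
have Y' : 0 <= M ^+ 2 * (lam * (t ^+ 2 - S ^+ 2) / r + K * h - r * Qm * t ^+ 2).
  rewrite mulr_ge0 ?sqr_ge0// -(pmulr_rge0 _ r0).
  have -> : r * (lam * (t ^+ 2 - S ^+ 2) / r + K * h - r * Qm * t ^+ 2) =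
    K * (r * h) + lam * (t ^+ 2 - S ^+ 2) - r ^+ 2 * Qm * t ^+ 2.
    by field; rewrite gt_eqF.
  by rewrite subr_ge0.
have sq := sqr_ge0 (W - e * (Num.sqrt lam * M * S / Num.sqrt r)).
have QB : 0 <= (Q + Qm) * (t * M * Num.sqrt r) ^+ 2.
  by rewrite mulr_ge0 ?sqr_ge0//; lra.
rewrite -subr_ge0.
(* The deficit is a sum of three nonnegative terms: the completed square, the Young deficit scaled
   by [M^2 / r], and [(Q + Qm) u^2]. *)
have -> : W ^+ 2 + lam * ((t * M * Num.sqrt r) ^+ 2 / r ^+ 2) +
     Q * (t * M * Num.sqrt r) ^+ 2 -
   (e * (2 * Num.sqrt lam * M * S * (W / Num.sqrt r)) - M ^+ 2 * (K * h)) =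
   (W - e * (Num.sqrt lam * M * S / Num.sqrt r)) ^+ 2 +
   M ^+ 2 * (lam * (t ^+ 2 - S ^+ 2) / r + K * h - r * Qm * t ^+ 2) +
   (Q + Qm) * (t * M * Num.sqrt r) ^+ 2.
  have -> : (W - e * (Num.sqrt lam * M * S / Num.sqrt r)) ^+ 2 =
    W ^+ 2 - 2 * W * e * (Num.sqrt lam * M * S / Num.sqrt r) +
    e ^+ 2 * (Num.sqrt lam ^+ 2 * (M * S) ^+ 2 / Num.sqrt r ^+ 2).
    by field; rewrite gt_eqF.
  rewrite e1 sl2 !exprMn sr2.
  by field; rewrite !gt_eqF.
by rewrite !addr_ge0.
Qed.
End Pointwise.

Section Interval.
Context {R : realType}.
Notation mu := (@lebesgue_measure R).

Lemma Rintegral_itv_cat (f : R -> R) (a c b : R) : a <= c <= b ->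
  mu.-integrable `[a, b] (EFin \o f) ->
  \int[mu]_(x in `[a, b]) f x = \int[mu]_(x in `[a, c]) f x + \int[mu]_(x in `[c, b]) f x.
Proof.
move=> /andP[ac cb] fi.
have := @Rintegral_itvB _ f (BLeft a) (BRight b) c fi.
rewrite !bnd_simp => /(_ ac cb) h.
rewrite -(@Rintegral_itv_obnd_cbnd _ c (BRight b)); last first.
  apply: integrableS fi => // x /=; rewrite !in_itv /= => /andP[cx ->].
  by rewrite (le_trans ac (ltW cx)).
by rewrite -h addrC subrK.
Qed.

Lemma integrable_continuous_itv (f : R -> R) (a b : R) :
  (forall x, a <= x <= b -> {for x, continuous f}) ->
  mu.-integrable `[a, b] (EFin \o f).
Proof.
move=> cf; apply: continuous_compact_integrable; first exact: segment_compact.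
by apply: continuous_in_subspaceT => x; rewrite inE /= in_itv /=; exact: cf.
Qed.

(** Only [B'] goes through the fundamental theorem of calculus; [h] is merely integrable, because
    [Q_-] is only measurable. *)
Lemma Rintegral_FTC_ge (G B B' h : R -> R) (c a b : R) : a < b ->
  (forall x, a <= x <= b -> {for x, continuous G}) ->
  (forall x, a <= x <= b -> {for x, continuous B'}) ->
  (forall x, a <= x <= b -> is_derive x 1 B (B' x)) ->
  mu.-integrable `[a, b] (EFin \o h) ->
  (forall x, a <= x <= b -> B' x - c * h x <= G x) ->
  B b - B a - c * (\int[mu]_(x in `[a, b]) h x) <= \int[mu]_(x in `[a, b]) G x.
Proof.
move=> ab cG cB dB hi hle.
have iB := integrable_continuous_itv cB.
have ich : mu.-integrable `[a, b] (EFin \o (fun x => c * h x)).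
  have -> : EFin \o (fun x => c * h x) = (fun x => c%:E * (EFin \o h) x)%E by [].
  exact: integrableZl.
have -> : B b - B a = \int[mu]_(x in `[a, b]) B' x.
  have cB0 x : a <= x <= b -> {for x, continuous B}.
    by move=> axb; exact: is_derive_continuous (dB x axb).
  have dB0 x : a < x < b -> is_derive x 1 B (B' x).
    by move=> axb; apply: dB; case/andP: axb => /ltW-> /ltW->.
  by rewrite /Rintegral (integral_FTC ab cB cB0 dB0).
rewrite -RintegralZl// -RintegralB//; apply: le_Rintegral => //.
- have -> : EFin \o (fun x => B' x - c * h x) =
    (fun x => (EFin \o B') x - (EFin \o (fun x => c * h x)%R) x)%E by [].
  exact: integrableB.
- exact: integrable_continuous_itv.
Qed.

Section PointwiseContinuity.
Variables (f g : R -> R) (x : R).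
Hypotheses (cf : {for x, continuous f}) (cg : {for x, continuous g}).
Lemma contD : {for x, continuous (fun y => f y + g y)}. Proof. exact: cvgD. Qed.
Lemma contN : {for x, continuous (fun y => - f y)}. Proof. exact: cvgN. Qed.
Lemma contM : {for x, continuous (fun y => f y * g y)}. Proof. exact: cvgM. Qed.
Lemma contV : f x != 0 -> {for x, continuous (fun y => (f y)^-1)}.
Proof. by move=> fx; exact: cvgV. Qed.
Lemma contX2 : {for x, continuous (fun y => f y ^+ 2)}.
Proof. by apply: (@continuous_comp _ _ _ f (fun y => y ^+ 2)) => //; exact: exprn_continuous. Qed.
End PointwiseContinuity.

(** The integrand of [<A u, u>] as it stands, with [- u'' u] instead of [u'^2]. The boundary term
    [- u u'] of the integration by parts is absorbed in [bnd] below. *)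
Definition radial_density (alpha : R) (Q u u2 : R -> R) (r : R) : R :=
  - (u2 r * u r) + alpha * (u r ^+ 2 / r ^+ 2) + Q r * u r ^+ 2.

Definition mass_density (k : R) (Qm : R -> R) (r : R) : R := r `^ (2 * k - 1) * Qm r `^ k.

Section Bump.
Variables (alpha k : R) (F Q Qm u u1 u2 : R -> R) (p q : R).
Hypotheses (halpha : 0 < alpha + 1 / 4) (hk : 1 < k).
Hypothesis dF : forall t : R, -2 < t < 2 -> is_derive t 1 F (soliton k t).
Hypothesis cQ : forall r, 0 < r -> {for r, continuous Q}.
Hypothesis Qm0 : forall r, 0 < r -> 0 <= Qm r.
Hypothesis QQm : forall r, 0 < r -> - Qm r <= Q r.
Hypothesis du : forall r : R, is_derive r 1 u (u1 r).
Hypothesis du1 : forall r : R, is_derive r 1 u1 (u2 r).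
Hypothesis cu2 : continuous u2.
Hypotheses (p0 : 0 < p) (up : u p = 0) (uq : u q = 0).
Hypothesis hi : mu.-integrable `[p, q] (EFin \o mass_density k Qm).

Let lam := alpha + 1 / 4.
Let cu : continuous u. Proof. by move=> r; exact: is_derive_continuous (du r). Qed.
Let cu1 : continuous u1. Proof. by move=> r; exact: is_derive_continuous (du1 r). Qed.

Lemma radial_density_continuous (r : R) : 0 < r ->
  {for r, continuous (radial_density alpha Q u u2)}.
Proof using cQ du cu2.
move=> r0; have cur := @cu r; have cu2r := @cu2 r; have cQr := cQ r0.
apply: contD; first apply: contD.
- by apply: contN; exact: contM.
- apply: contM; first exact: cvg_cst.
  apply: contM; first exact: contX2.
  by apply: contV; [exact: exprn_continuous|rewrite expf_neq0 ?gt_eqF].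
- by apply: contM => //; exact: contX2.
Qed.

Let v (r : R) : R := u r / Num.sqrt r.
Let W (r : R) : R := u1 r - u r / (2 * r).

Let dv (r : R) : 0 < r -> is_derive r 1 v (W r / Num.sqrt r).
Proof.
move=> r0; have sr : 0 < Num.sqrt r by rewrite sqrtr_gt0.
have sr2 : Num.sqrt r ^+ 2 = r by rewrite sqr_sqrtr ?ltW.
have h := is_derive_invf (negbT (gt_eqF sr)) (is_derive1_sqrt r0).
apply: is_derive_eq (is_derive_mulf (du r) h) _.
rewrite /W; move: (u r) (u1 r) => y z; set s := Num.sqrt r in sr sr2 *.
by rewrite -[X in _ / (2 * X)]sr2; field; rewrite gt_eqF.
Qed.

(** The term [- u u'] trades [- u'' u] for [u'^2], and [u^2 / (2r)] turns [u'^2 + alpha u^2 / r^2]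
    into [W^2 + lam u^2 / r^2]. The last term differentiates to the cross term of the completed
    square, as [v' = W / sqrt r]. *)
Let bnd (M e r : R) : R :=
  - (u r * u1 r) + u r ^+ 2 * (2 * r)^-1 + e * (2 * Num.sqrt lam * M ^+ 2 * F (v r / M)).
Let bnd' (M e r : R) : R :=
  - (u1 r ^+ 2 + u r * u2 r) + (u r * u1 r / r - u r ^+ 2 / (2 * r ^+ 2)) +
  e * (2 * Num.sqrt lam * M * (soliton k (v r / M) * (W r / Num.sqrt r))).

Let dbnd (M e r : R) : 0 < r -> 0 < M -> `|v r| <= M ->
  is_derive r 1 (bnd M e) (bnd' M e r).
Proof.
move=> r0 M0 vM.
have t1 : `|v r / M| <= 1.
  by rewrite normrM normfV (gtr0_norm M0) ler_pdivrMr// mul1r.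
have t2 : -2 < v r / M < 2 by move: t1; rewrite ler_norml => /andP[]; lra.
have d2r := is_derive_scalef 2 (is_derive_id r (1 : R)).
have r2 : 2 * r != 0 by rewrite mulf_neq0 ?gt_eqF.
have d2 := is_derive_invf r2 d2r.
have dvM := is_derive_mulf (dv r0) (is_derive_cst (M^-1) r (1 : R)).
have dFv := @is_derive_compf _ (fun x => v x / M) F _ _ _ (dF t2) dvM.
have duu := is_derive_mulf (du r) (du r).
have h := is_derive_addf (is_derive_addf (is_derive_oppf (is_derive_mulf (du r) (du1 r)))
  (is_derive_mulf duu d2)) (is_derive_scalef e (is_derive_scalef (2 * Num.sqrt lam * M ^+ 2) dFv)).
apply: is_derive_eq h _; rewrite /bnd' /cst mulr0 addr0.
by field; rewrite !gt_eqF// sqrtr_gt0.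
Qed.

Let cbnd' (M e r : R) : 0 < r -> 0 < M -> {for r, continuous (bnd' M e)}.
Proof.
move=> r0 M0; have cv : {for r, continuous v} by exact: is_derive_continuous (dv r0).
have r2 : 2 * r != 0 by rewrite mulf_neq0 ?gt_eqF.
have rr2 : 2 * r ^+ 2 != 0 by rewrite mulf_neq0 ?expf_neq0 ?gt_eqF.
have rn : r != 0 by rewrite gt_eqF.
have cid : {for r, continuous (fun x : R => x)} by exact: cvg_id.
have cc (c : R) : {for r, continuous (fun _ : R => c)} by exact: cvg_cst.
have cur := @cu r; have cu1r := @cu1 r; have cu2r := @cu2 r.
have cW : {for r, continuous W}.
  apply: contD => //; apply: contN; apply: contM => //.
  by apply: contV => //; exact: contM.
apply: contD; first apply: contD.
- by apply: contN; apply: contD; [exact: contX2|exact: contM].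
- apply: contD; first by apply: contM; [exact: contM|exact: contV].
  apply: contN; apply: contM; first exact: contX2.
  by apply: contV => //; apply: contM => //; exact: contX2.
- apply: contM => //; apply: contM => //; apply: contM.
    apply: (@continuous_comp _ _ _ (fun x => v x / M) (soliton k)); last exact: soliton_continuous.
    exact: contM.
  apply: contM => //; apply: contV; last by rewrite gt_eqF ?sqrtr_gt0.
  exact: sqrt_continuous.
Qed.

Let pointwise (M e r : R) : 0 < r -> 0 < M -> `|v r| <= M -> e ^+ 2 = 1 ->
  bnd' M e r - M ^+ 2 * young_const k lam * mass_density k Qm r <=
  radial_density alpha Q u u2 r.
Proof.
move=> r0 M0 vM e1.
have t1 : `|v r / M| <= 1.
  by rewrite normrM normfV (gtr0_norm M0) ler_pdivrMr// mul1r.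
have sr : 0 < Num.sqrt r by rewrite sqrtr_gt0.
have ue : u r = v r / M * M * Num.sqrt r by rewrite /v; field; rewrite !gt_eqF.
have := radial_pointwise (W r) hk halpha r0 (Qm0 r0) (QQm r0) t1 e1 ue.
rewrite -/lam /bnd' /radial_density /mass_density /W.
set S := soliton _ _ * _; set K := young_const _ _; set h := _ `^ _ * _ => H.
rewrite -subr_ge0; rewrite -subr_ge0 in H; apply: le_trans H _.
rewrite le_eqVlt; apply/orP; left; apply/eqP; rewrite /S /lam.
by field; rewrite !gt_eqF.
Qed.

Lemma positive_bump_bound (M x0 : R) : p <= x0 <= q -> 0 < M -> u x0 / Num.sqrt x0 = M ->
  (forall r, p <= r <= q -> `|u r / Num.sqrt r| <= M) ->
  M ^+ 2 * (4 * Num.sqrt lam * (F 1 - F 0) -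
    young_const k lam * \int[mu]_(r in `[p, q]) mass_density k Qm r) <=
  \int[mu]_(r in `[p, q]) radial_density alpha Q u u2 r.
Proof.
move=> /[dup] x0pq /andP[px xq] M0 vx vM.
have vp : v p = 0 by rewrite /v up mul0r.
have vq : v q = 0 by rewrite /v uq mul0r.
have {}px : p < x0.
  by rewrite lt_neqAle px andbT; apply: contraTneq M0 => pe; rewrite -vx -pe -/(v p) vp ltxx.
have {}xq : x0 < q.
  by rewrite lt_neqAle xq andbT; apply: contraTneq M0 => pe; rewrite -vx pe -/(v q) vq ltxx.
have x00 : 0 < x0 by exact: lt_trans px.
have half (e a b : R) : p <= a -> a < b -> b <= q -> e ^+ 2 = 1 ->
    bnd M e b - bnd M e a - M ^+ 2 * young_const k lam *
      (\int[mu]_(r in `[a, b]) mass_density k Qm r) <=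
    \int[mu]_(r in `[a, b]) radial_density alpha Q u u2 r.
  move=> pa ab bq e1.
  have sub (x : R) : a <= x <= b -> 0 < x /\ p <= x <= q.
    by move=> /andP[ax xb]; rewrite (le_trans pa ax) (le_trans xb bq);
      split=> //; exact: lt_le_trans (lt_le_trans p0 pa) ax.
  apply: (@Rintegral_FTC_ge _ (bnd M e) (bnd' M e)) => //.
  - by move=> x /sub[x_gt0 _]; exact: radial_density_continuous.
  - by move=> x /sub[x_gt0 _]; exact: cbnd'.
  - by move=> x /sub[x_gt0 xpq]; apply: dbnd => //; exact: vM.
  - apply: integrableS hi => // x /=; rewrite !in_itv /= => /sub[_ //].
  - by move=> x /sub[x_gt0 xpq]; apply: pointwise => //; exact: vM.
have ird : mu.-integrable `[p, q] (EFin \o radial_density alpha Q u u2).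
  apply: integrable_continuous_itv => x /andP[px' _].
  by apply: radial_density_continuous; exact: lt_le_trans p0 px'.
rewrite (Rintegral_itv_cat x0pq ird) (Rintegral_itv_cat x0pq hi).
have e1 : (1 : R) ^+ 2 = 1 by rewrite expr1n.
have e2 : (-1 : R) ^+ 2 = 1 by rewrite sqrrN expr1n.
(* The terms of [bnd] free of [e] cancel at [x0] and vanish at [p] and [q]. In the term with [F],
   each half contributes [2 sqrt lam M^2 (F 1 - F 0)], since [v / M] is 1 at [x0] and 0 at the
   ends. *)
apply: le_trans (lerD (half 1 p x0 (lexx _) px (ltW xq) e1)
                      (half (-1) x0 q (ltW px) xq (lexx _) e2)).
rewrite /bnd -/(v x0) -/(v p) -/(v q) in vx *.
rewrite vx vp vq up uq !mul0r divff ?gt_eqF//.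
rewrite le_eqVlt; apply/orP; left; apply/eqP.
by ring.
Qed.
End Bump.
End Interval.

(** * Cutting an interval into pieces of bounded mass *)

Section Splitting.
Context {R : realType}.
Notation mu := (@lebesgue_measure R).

(** Greedy cutting: by the intermediate value theorem the first piece is given mass exactly [c0],
    and induction handles the rest. The partition is expressed only through its consequence for
    integrals of an arbitrary [G], with endpoints ranging over the whole list, so no ordering of the
    points has to be recorded. *)
Lemma exists_splitting (g : R -> R) (c0 a b : R) (n : nat) : 0 < c0 -> a < b ->
  mu.-integrable `[a, b] (EFin \o g) ->
  \int[mu]_(x in `[a, b]) g x <= n.+1%:R * c0 ->
  exists s : seq R, [/\ size s = n, forall t, t \in s -> a <= t <= b &
    forall G : R -> R, mu.-integrable `[a, b] (EFin \o G) ->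
      (forall p q, p \in [:: a, b & s] -> q \in [:: a, b & s] -> a <= p -> p < q -> q <= b ->
        \int[mu]_(x in `[p, q]) g x <= c0 -> 0 <= \int[mu]_(x in `[p, q]) G x) ->
      0 <= \int[mu]_(x in `[a, b]) G x].
Proof.
move=> c00; elim: n a => [|n IH] a ab gi hg.
  exists [::]; split=> // G Gi; apply; rewrite ?inE ?eqxx ?orbT// ?lexx//.
  by rewrite mul1r in hg.
have [h|h] := leP (\int[mu]_(x in `[a, b]) g x) c0.
  exists (nseq n.+1 b); split; first by rewrite size_nseq.
    by move=> t /nseqP[-> _]; rewrite lexx ltW.
  by move=> G Gi; apply=> //; rewrite inE ?eqxx// inE eqxx orbT.
have [t tab ht] : exists2 t, t \in `[a, b]%R & \int[mu]_(x in `[a, t]) g x = c0.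
  apply: (@IVT _ (fun t => \int[mu]_(x in `[a, t]) g x)); first exact: ltW.
    exact: parameterized_integral_continuous (ltW ab) gi.
  rewrite set_itv1 Rintegral_set1 ge_min le_max (ltW c00) (ltW h).
  by rewrite orbT.
move: tab; rewrite in_itv /= => /andP[a_t tb].
have {}tb : t < b.
  by rewrite lt_neqAle tb andbT; apply: contraTneq h => tE; rewrite -tE ht ltxx.
have {}a_t : a < t.
  rewrite lt_neqAle a_t andbT; apply: contraTneq c00 => tE.
  by rewrite -ht -tE set_itv1 Rintegral_set1 ltxx.
have tab : a <= t <= b by rewrite !ltW.
have subi (f : R -> R) : mu.-integrable `[a, b] (EFin \o f) ->
    mu.-integrable `[t, b] (EFin \o f).
  apply: integrableS => // x /=; rewrite !in_itv /= => /andP[tx ->].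
  by rewrite (le_trans (ltW a_t) tx).
have htb : \int[mu]_(x in `[t, b]) g x <= n.+1%:R * c0.
  move: hg; rewrite (Rintegral_itv_cat tab gi) ht -natr1 mulrDl mul1r.
  by rewrite addrC lerD2r.
have [s [ss st hs]] := IH t tb (subi _ gi) htb.
exists (t :: s); split; first by rewrite /= ss.
  move=> x; rewrite inE => /predU1P[->|/st /andP[tx ->]]; first exact: tab.
  by rewrite (le_trans (ltW a_t) tx).
move=> G Gi hG; rewrite (Rintegral_itv_cat tab Gi) addr_ge0//.
  by apply: hG => //; rewrite ?inE ?eqxx ?orbT ?lexx ?(ltW tb)// ht.
apply: hs => [|p q ps qs tp pq qb]; first exact: subi.
apply: hG => //.
- by move: ps; rewrite !inE => /or3P[->|->|->]; rewrite ?orbT.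
- by move: qs; rewrite !inE => /or3P[->|->|->]; rewrite ?orbT.
- exact: le_trans (ltW a_t) tp.
Qed.

Variables (alpha k : R) (F Q Qm : R -> R).
Hypotheses (halpha : 0 < alpha + 1 / 4) (hk : 1 < k).
Hypothesis dF : forall t : R, -2 < t < 2 -> is_derive t 1 F (soliton k t).
Hypothesis cQ : forall r, 0 < r -> {for r, continuous Q}.
Hypothesis Qm0 : forall r, 0 < r -> 0 <= Qm r.
Hypothesis QQm : forall r, 0 < r -> - Qm r <= Q r.

(** The maximum of [|u| / sqrt r] is attained on the compact interval. If it is 0 the density
    vanishes identically; otherwise [positive_bump_bound] applies to [u] or, when the extreme value
    is negative, to [- u]. *)
Lemma interval_form_ge0 (u u1 u2 : R -> R) (p q : R) :
  (forall r : R, is_derive r 1 u (u1 r)) -> (forall r : R, is_derive r 1 u1 (u2 r)) ->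
  continuous u2 -> 0 < p -> p < q -> u p = 0 -> u q = 0 ->
  mu.-integrable `[p, q] (EFin \o mass_density k Qm) ->
  young_const k (alpha + 1 / 4) * \int[mu]_(r in `[p, q]) mass_density k Qm r <=
    4 * Num.sqrt (alpha + 1 / 4) * (F 1 - F 0) ->
  0 <= \int[mu]_(r in `[p, q]) radial_density alpha Q u u2 r.
Proof using dF cQ Qm0 QQm halpha hk.
move=> du du1 cu2 p0 pq up uq hi hmass.
pose v r := `|u r / Num.sqrt r|.
have cv (r : R) : 0 < r -> {for r, continuous v}.
  move=> r0; apply: (@continuous_comp _ _ _ (fun r => u r / Num.sqrt r) (fun y : R => `|y|)).
    apply: contM; first exact: is_derive_continuous (du r).
    by apply: contV; [exact: sqrt_continuous|rewrite gt_eqF ?sqrtr_gt0].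
  exact: norm_continuous.
have [x0 x0pq vmax] : exists2 c, c \in `[p, q]%R & forall t, t \in `[p, q]%R -> v t <= v c.
  apply: EVT_max (ltW pq) _; apply: continuous_in_subspaceT => x.
  by rewrite inE /= in_itv /= => /andP[px _]; apply: cv; exact: lt_le_trans px.
rewrite in_itv /= in x0pq.
have x00 : 0 < x0 by case/andP: x0pq => px _; exact: lt_le_trans px.
have [vx0|M0] := eqVneq (v x0) 0.
  apply: Rintegral_ge0 => r /=; rewrite in_itv /= => rpq.
  have r0 : 0 < r by case/andP: rpq => pr _; exact: lt_le_trans pr.
  have : v r <= 0 by rewrite -vx0; apply: vmax; rewrite in_itv.
  rewrite normr_le0 mulf_eq0 invr_eq0 [Num.sqrt _ == 0]gt_eqF ?sqrtr_gt0// orbF => /eqP ur.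
  by rewrite /radial_density ur expr0n /= mul0r !mulr0 oppr0 !addr0.
have {}M0 : 0 < v x0 by rewrite lt_neqAle eq_sym M0 normr_ge0.
have vM r : p <= r <= q -> `|u r / Num.sqrt r| <= v x0 by move=> rpq; apply: vmax; rewrite in_itv.
suff h : v x0 ^+ 2 * (4 * Num.sqrt (alpha + 1 / 4) * (F 1 - F 0) -
    young_const k (alpha + 1 / 4) * \int[mu]_(r in `[p, q]) mass_density k Qm r) <=
    \int[mu]_(r in `[p, q]) radial_density alpha Q u u2 r.
  by apply: le_trans h; rewrite mulr_ge0 ?sqr_ge0// subr_ge0.
have [w0|w0] := leP 0 (u x0 / Num.sqrt x0).
  have vx : u x0 / Num.sqrt x0 = v x0 by rewrite /v ger0_norm.
  exact: (positive_bump_bound halpha hk dF cQ Qm0 QQm du du1 cu2 p0 up uq hi x0pq M0 vx vM).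
have -> : radial_density alpha Q u u2 = radial_density alpha Q (fun r => - u r) (fun r => - u2 r).
  by apply/funext => r; rewrite /radial_density sqrrN mulrNN.
have dun (r : R) := is_derive_oppf (du r); have du1n (r : R) := is_derive_oppf (du1 r).
have cu2n : continuous (fun r => - u2 r) by move=> r; apply: contN; exact: cu2.
have upn : - u p = 0 by rewrite up oppr0.
have uqn : - u q = 0 by rewrite uq oppr0.
have vx : - u x0 / Num.sqrt x0 = v x0 by rewrite mulNr /v ltr0_norm.
apply: (positive_bump_bound halpha hk dF cQ Qm0 QQm dun du1n cu2n p0 upn uqn hi x0pq M0 vx).
by move=> r rpq; rewrite mulNr normrN; exact: vM.
Qed.

(** The order of quantifiers is the point: [s] is chosen before [u], so vanishing on [s] is a fixed
    set of [n] linear conditions. *)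
Lemma split_form_ge0 (a b : R) (n : nat) : 0 < a -> a < b ->
  mu.-integrable `[a, b] (EFin \o mass_density k Qm) -> F 0 < F 1 ->
  young_const k (alpha + 1 / 4) * \int[mu]_(r in `[a, b]) mass_density k Qm r <=
    n.+1%:R * (4 * Num.sqrt (alpha + 1 / 4) * (F 1 - F 0)) ->
  exists s : seq R, size s = n /\
    forall u u1 u2 : R -> R,
    (forall r : R, is_derive r 1 u (u1 r)) -> (forall r : R, is_derive r 1 u1 (u2 r)) ->
    continuous u2 -> u a = 0 -> u b = 0 -> (forall t, t \in s -> u t = 0) ->
    0 <= \int[mu]_(r in `[a, b]) radial_density alpha Q u u2 r.
Proof using dF cQ Qm0 QQm halpha hk.
move=> a0 ab hi F01 hmass.
pose K := young_const k (alpha + 1 / 4); have K0 : 0 < K by exact: young_const_gt0.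
pose c0 := 4 * Num.sqrt (alpha + 1 / 4) * (F 1 - F 0) / K.
have c00 : 0 < c0 by rewrite divr_gt0// !mulr_gt0 ?sqrtr_gt0// subr_gt0.
have hc : \int[mu]_(r in `[a, b]) mass_density k Qm r <= n.+1%:R * c0.
  by rewrite /c0 mulrA ler_pdivlMr// mulrC.
have [s [ss _ hs]] := exists_splitting c00 ab hi hc.
exists s; split=> // u u1 u2 du du1 cu2 ua ub us.
apply: hs => [|p q ps qs ap pq qb hpq].
  apply: integrable_continuous_itv => x /andP[ax _].
  exact: (@radial_density_continuous _ alpha Q u u1 u2 cQ du cu2 x (lt_le_trans a0 ax)).
have zero x : x \in [:: a, b & s] -> u x = 0 by rewrite !inE => /or3P[/eqP->|/eqP->|/us].
apply: (interval_form_ge0 du du1 cu2) => //.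
- exact: lt_le_trans ap.
- exact: zero.
- exact: zero.
- apply: integrableS hi => // x /=; rewrite !in_itv /= => /andP[px xq].
  by rewrite (le_trans ap px) (le_trans xq qb).
- by rewrite mulrC -ler_pdivlMr.
Qed.
End Splitting.

(** * Square-integrable functions *)

Section RealL2.
Context {R : realType}.
Notation mu := (@lebesgue_measure R).
Implicit Types f g h : R -> R.

Definition RL2 f : Prop :=
  measurable_fun Rpos f /\ (\int[mu]_(r in Rpos) (f r ^+ 2)%:E < +oo)%E.

Definition rip f g : R := \int[mu]_(r in Rpos) (f r * g r).

Lemma RL2_sqr_integrable f : RL2 f -> mu.-integrable Rpos (fun r => (f r ^+ 2)%:E).
Proof.
move=> [mf fi]; apply/integrableP; split.
  by apply/measurable_EFinP; exact: measurable_funX.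
by under eq_integral do rewrite abse_EFin ger0_norm ?sqr_ge0//.
Qed.

Lemma RL2_integrable f g : RL2 f -> RL2 g -> mu.-integrable Rpos (fun r => (f r * g r)%:E).
Proof.
move=> hf hg.
have h : mu.-integrable Rpos (fun r => (f r ^+ 2)%:E + (g r ^+ 2)%:E)%E.
  by apply: integrableD => //; exact: RL2_sqr_integrable.
apply: (le_integrable _ _ _ h) => //.
  by apply/measurable_EFinP; apply: measurable_funM; [case: hf|case: hg].
move=> r _; rewrite -EFinD !abse_EFin lee_fin [leRHS]ger0_norm ?addr_ge0 ?sqr_ge0//.
have h1 := sqr_ge0 (f r - g r); have h2 := sqr_ge0 (f r + g r).
rewrite sqrrB sqrrD in h1 h2.
have h3 := sqr_ge0 (f r); have h4 := sqr_ge0 (g r).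
by rewrite ler_norml; apply/andP; split; lra.
Qed.

Lemma RL2D f g : RL2 f -> RL2 g -> RL2 (fun r => f r + g r).
Proof.
move=> hf hg; have [mf _] := hf; have [mg _] := hg.
split; first exact: measurable_funD.
have h : mu.-integrable Rpos (fun r => (f r ^+ 2)%:E + (g r ^+ 2)%:E)%E.
  by apply: integrableD => //; exact: RL2_sqr_integrable.
have {}h : mu.-integrable Rpos (fun r => 2%:E * ((f r ^+ 2)%:E + (g r ^+ 2)%:E))%E.
  exact: integrableZl.
have : mu.-integrable Rpos (fun r => ((f r + g r) ^+ 2)%:E).
  apply: (le_integrable _ _ _ h) => //.
    by apply/measurable_EFinP; apply: measurable_funX; exact: measurable_funD.
  move=> r _; rewrite -EFinD -EFinM !abse_EFin lee_fin.
  rewrite !ger0_norm ?sqr_ge0//; last by rewrite mulr_ge0// addr_ge0 ?sqr_ge0.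
  by have := sqr_ge0 (f r - g r); rewrite sqrrB sqrrD; lra.
move/integrableP => [_]; under eq_integral do rewrite abse_EFin ger0_norm ?sqr_ge0//.
by [].
Qed.

Lemma RL2Z (c : R) f : RL2 f -> RL2 (fun r => c * f r).
Proof.
move=> hf; have [mf _] := hf; split; first exact: measurable_funM.
have : mu.-integrable Rpos (fun r => (c ^+ 2)%:E * (f r ^+ 2)%:E)%E.
  by apply: integrableZl => //; exact: RL2_sqr_integrable.
move/integrableP => [_]; congr (_ < _)%E; apply: eq_integral => r _.
by rewrite -EFinM -exprMn abse_EFin ger0_norm ?sqr_ge0.
Qed.

Lemma RL2B f g : RL2 f -> RL2 g -> RL2 (fun r => f r - g r).
Proof.
move=> hf hg; rewrite (_ : (fun _ => _) = (fun r => f r + -1 * g r)).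
  by apply: RL2D => //; exact: RL2Z.
by apply/funext => r; rewrite mulN1r.
Qed.

Lemma RL2_0 : RL2 (fun=> 0).
Proof.
split; first exact: measurable_cst.
by under eq_integral do rewrite expr0n /=; rewrite integral0.
Qed.

Lemma ripC f g : rip f g = rip g f.
Proof. by apply: eq_Rintegral => r _; rewrite mulrC. Qed.

Lemma ripDl f g h : RL2 f -> RL2 g -> RL2 h ->
  rip (fun r => f r + g r) h = rip f h + rip g h.
Proof.
move=> hf hg hh; rewrite /rip -RintegralD//; last 2 first.
- exact: RL2_integrable.
- exact: RL2_integrable.
by apply: eq_Rintegral => r _; rewrite mulrDl.
Qed.

Lemma ripZl (c : R) f g : RL2 f -> RL2 g -> rip (fun r => c * f r) g = c * rip f g.
Proof.
move=> hf hg; rewrite /rip -RintegralZl//; last exact: RL2_integrable.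
by apply: eq_Rintegral => r _; rewrite mulrA.
Qed.

Lemma ripBl f g h : RL2 f -> RL2 g -> RL2 h ->
  rip (fun r => f r - g r) h = rip f h - rip g h.
Proof.
move=> hf hg hh; have hg' := RL2Z (-1) hg.
rewrite (_ : (fun _ => _) = (fun r => f r + -1 * g r)).
  by rewrite ripDl// ripZl// mulN1r.
by apply/funext => r; rewrite mulN1r.
Qed.

Lemma rip_ge0 f : 0 <= rip f f.
Proof. by apply: Rintegral_ge0 => r _; rewrite -expr2 sqr_ge0. Qed.

Lemma EFin_rip f : RL2 f -> (rip f f)%:E = (\int[mu]_(r in Rpos) (f r ^+ 2)%:E)%E.
Proof.
move=> hf; rewrite /rip /Rintegral fineK//; last exact/integrable_fin_num/RL2_integrable.
Qed.

Lemma rip_cauchy_schwarz f g : RL2 f -> RL2 g -> rip f g ^+ 2 <= rip f f * rip g g.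
Proof.
move=> hf hg.
have key (s t : R) : 0 <= s ^+ 2 * rip f f - 2 * s * t * rip f g + t ^+ 2 * rip g g.
  have hsf := RL2Z s hf; have htg := RL2Z t hg.
  have := rip_ge0 (fun r => s * f r - t * g r).
  rewrite ripBl//; last exact: RL2B.
  rewrite (ripC (fun r => s * f r)) (ripC (fun r => t * g r)) !ripBl//.
  rewrite !ripZl// (ripC f (fun r => s * f r)) (ripC g (fun r => s * f r)).
  rewrite (ripC f (fun r => t * g r)) (ripC g (fun r => t * g r)) !ripZl// (ripC g f).
  by set x := rip f f; set y := rip f g; set z := rip g g; move=> /le_trans; apply;
    rewrite le_eqVlt; apply/orP; left; apply/eqP; ring.
move: key; set x := rip f f; set y := rip f g; set z := rip g g => key.
have [z0|zN] := eqVneq z 0.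
  have [->|yN] := eqVneq y 0; first by rewrite z0 expr0n /= mulr0.
  (* When [z = 0] the quadratic form is affine in [t]; this [t] gives it the value -1, a
     contradiction. *)
  have := key 1 ((x + 1) / (2 * y)).
  rewrite (_ : _ + _ = -1) ?ler0N1 ?oppr_ge0 ?ler10//.
  by rewrite z0; field.
have z0 : 0 < z by rewrite lt_neqAle eq_sym zN rip_ge0.
(* The minimising ratio [t / s = y / z], with denominators cleared. *)
have := key z y; rewrite (_ : _ + _ = z * (x * z - y ^+ 2)); last by ring.
by rewrite pmulr_rge0// subr_ge0.
Qed.

Lemma rip_normr f g : RL2 f -> RL2 g -> `|rip f g| <= Num.sqrt (rip f f) * Num.sqrt (rip g g).
Proof.
move=> hf hg; rewrite -sqrtrM ?rip_ge0// -sqrtr_sqr ler_sqrt ?mulr_ge0 ?rip_ge0//.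
exact: rip_cauchy_schwarz.
Qed.

Lemma rip_cvg0 (f_ g_ : nat -> R -> R) (M : R) :
  (forall n, RL2 (f_ n)) -> (forall n, RL2 (g_ n)) ->
  (fun n => rip (f_ n) (f_ n)) @ \oo --> 0 ->
  (fun n => rip (g_ n) (g_ n)) @ \oo --> M ->
  (fun n => rip (f_ n) (g_ n)) @ \oo --> 0.
Proof.
move=> hf hg cf cg; apply/norm_cvg0P.
pose B n := Num.sqrt (rip (f_ n) (f_ n)) * Num.sqrt (rip (g_ n) (g_ n)).
apply: (@squeeze_cvgr _ _ _ _ (fun=> 0) B).
- by near=> n; rewrite normr_ge0 /=; exact: rip_normr.
- exact: cvg_cst.
- rewrite -[X in _ --> X](mul0r (Num.sqrt M)); apply: cvgM.
    rewrite -[X in _ --> X](@sqrtr0 R).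
    by apply: continuous_cvg cf; exact: sqrt_continuous.
  by apply: continuous_cvg cg; exact: sqrt_continuous.
Unshelve. all: by end_near. Qed.

Lemma rip_cvg (f_ g_ : nat -> R -> R) f g : RL2 f -> RL2 g ->
  (forall n, RL2 (f_ n)) -> (forall n, RL2 (g_ n)) ->
  (fun n => rip (fun r => f_ n r - f r) (fun r => f_ n r - f r)) @ \oo --> 0 ->
  (fun n => rip (fun r => g_ n r - g r) (fun r => g_ n r - g r)) @ \oo --> 0 ->
  (fun n => rip (f_ n) (g_ n)) @ \oo --> rip f g.
Proof.
move=> hf hg hf_ hg_ cf cg.
have df n := RL2B (hf_ n) hf; have dg n := RL2B (hg_ n) hg.
have E n : rip (f_ n) (g_ n) = rip f g + (rip (fun r => f_ n r - f r) (fun r => g_ n r - g r)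
    + (rip (fun r => f_ n r - f r) g + rip (fun r => g_ n r - g r) f)).
  rewrite (ripC (fun r => f_ n r - f r) (fun r => g_ n r - g r)) !ripBl//.
  rewrite (ripC (g_ n) (fun r => f_ n r - f r)) (ripC g (fun r => f_ n r - f r)) !ripBl//.
  by rewrite (ripC f (g_ n)) (ripC g f); ring.
rewrite (_ : (fun n => _) = (fun n => rip f g +
    (rip (fun r => f_ n r - f r) (fun r => g_ n r - g r)
    + (rip (fun r => f_ n r - f r) g + rip (fun r => g_ n r - g r) f)))); last exact/funext.
rewrite -[X in _ --> X]addr0; apply: cvgD; first exact: cvg_cst.
rewrite -[X in _ --> X]addr0; apply: cvgD; first exact: rip_cvg0 cf cg.
rewrite -[X in _ --> X]addr0; apply: cvgD.
  by apply: (rip_cvg0 (M := rip g g)) => //; exact: cvg_cst.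
by apply: (rip_cvg0 (M := rip f f)) => //; exact: cvg_cst.
Qed.
End RealL2.

(** * The complex inner product through real and imaginary parts *)

Section ComplexL2.
Context {R : realType}.
Notation mu := (@lebesgue_measure R).
Notation C := R[i].
Implicit Types f g h : R -> C.

Lemma conjC_complexE (x : C) : x^*%R = (complex.Re x -i* complex.Im x)%C.
Proof. by case: x. Qed.

Lemma Re_addE (x y : C) : complex.Re (x + y) = complex.Re x + complex.Re y.
Proof. by case: x; case: y. Qed.
Lemma Im_addE (x y : C) : complex.Im (x + y) = complex.Im x + complex.Im y.
Proof. by case: x; case: y. Qed.
Lemma Re_oppE (x : C) : complex.Re (- x) = - complex.Re x.
Proof. by case: x. Qed.
Lemma Im_oppE (x : C) : complex.Im (- x) = - complex.Im x.
Proof. by case: x. Qed.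
Lemma Re_mulE (x y : C) :
  complex.Re (x * y) = complex.Re x * complex.Re y - complex.Im x * complex.Im y.
Proof. by case: x; case: y. Qed.
Lemma Im_mulE (x y : C) :
  complex.Im (x * y) = complex.Re x * complex.Im y + complex.Im x * complex.Re y.
Proof. by case: x => a b; case: y => c d /=; rewrite addrC. Qed.

Lemma eqC (x y : C) : complex.Re x = complex.Re y -> complex.Im x = complex.Im y -> x = y.
Proof. by case: x => a b; case: y => c d /= -> ->. Qed.

Lemma L2P f : L2 f <-> RL2 (reF f) /\ RL2 (imF f).
Proof.
have Dge0 (p q : R -> R) (r : R) : (0 <= ((p r) ^+ 2)%:E + ((q r) ^+ 2)%:E)%E.
  by rewrite -EFinD lee_fin addr_ge0 ?sqr_ge0.
have E : measurable_fun Rpos (reF f) -> measurable_fun Rpos (imF f) ->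
    sqnormL2 f = (\int[mu]_(r in Rpos) (reF f r ^+ 2)%:E +
                  \int[mu]_(r in Rpos) (imF f r ^+ 2)%:E)%E.
  move=> m1 m2; rewrite /sqnormL2 -ge0_integralD//.
  - by move=> r _; rewrite lee_fin sqr_ge0.
  - by apply/measurable_EFinP; exact: measurable_funX.
  - by move=> r _; rewrite lee_fin sqr_ge0.
  - by apply/measurable_EFinP; exact: measurable_funX.
have i0 (p : R -> R) : (0 <= \int[mu]_(r in Rpos) (p r ^+ 2)%:E)%E.
  by apply: integral_ge0 => r _; rewrite lee_fin sqr_ge0.
split=> [[m1 m2]|[[m1 h1] [m2 h2]]].
  rewrite E// => h; split; split=> //; apply: le_lt_trans h.
    by rewrite leeDl.
  by rewrite leeDr.
by split=> //; rewrite E// lte_add_pinfty.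
Qed.

Lemma L2D f g : L2 f -> L2 g -> L2 (fun r => f r + g r).
Proof.
move=> /L2P[f1 f2] /L2P[g1 g2]; apply/L2P; split.
- rewrite (_ : reF _ = fun r => reF f r + reF g r); first exact: RL2D.
  by apply/funext => r; exact: Re_addE.
- rewrite (_ : imF _ = fun r => imF f r + imF g r); first exact: RL2D.
  by apply/funext => r; exact: Im_addE.
Qed.

Lemma L2Z (c : C) f : L2 f -> L2 (fun r => c * f r).
Proof.
move=> /L2P[f1 f2]; apply/L2P; split.
- rewrite (_ : reF _ = fun r => complex.Re c * reF f r - complex.Im c * imF f r).
    by apply: RL2B; exact: RL2Z.
  by apply/funext => r; exact: Re_mulE.
- rewrite (_ : imF _ = fun r => complex.Re c * imF f r + complex.Im c * reF f r).
    by apply: RL2D; exact: RL2Z.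
  by apply/funext => r; exact: Im_mulE.
Qed.

Lemma L2_0 : L2 (fun _ : R => 0 : C).
Proof. by apply/L2P; split; exact: RL2_0. Qed.

Lemma L2_sum (I : Type) (s : seq I) (c : I -> C) (f : I -> R -> C) :
  (forall i, L2 (f i)) -> L2 (fun r => \sum_(i <- s) c i * f i r).
Proof.
move=> hf; elim: s => [|i s IH].
  by rewrite (_ : (fun _ => _) = fun=> 0); [exact: L2_0|apply/funext => r; rewrite big_nil].
rewrite (_ : (fun _ => _) = fun r => c i * f i r + \sum_(i <- s) c i * f i r).
  by apply: L2D => //; exact: L2Z.
by apply/funext => r; rewrite big_cons.
Qed.

Lemma innerL2E f g : L2 f -> L2 g -> innerL2 f g =
  ((rip (reF f) (reF g) + rip (imF f) (imF g)) +i*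
   (rip (imF f) (reF g) - rip (reF f) (imF g)))%C.
Proof.
move=> /L2P[f1 f2] /L2P[g1 g2]; rewrite /innerL2 /cintegral; congr Complex.
  rewrite /rip -RintegralD//; try exact: RL2_integrable.
  apply: eq_Rintegral => r _.
  by rewrite {1}/reF Re_mulE conjC_complexE /= mulrN opprK.
rewrite /rip -RintegralB//; try exact: RL2_integrable.
apply: eq_Rintegral => r _.
by rewrite {1}/imF Im_mulE conjC_complexE /= mulrN addrC.
Qed.

Lemma innerL2_conj f g : L2 f -> L2 g -> innerL2 g f = (innerL2 f g)^*%R.
Proof.
move=> hf hg; rewrite !innerL2E// conjC_complexE /=; congr Complex.
  by rewrite ripC [X in _ + X]ripC.
by rewrite ripC [X in _ - X]ripC opprB.
Qed.

Lemma innerL2Dl f g h : L2 f -> L2 g -> L2 h ->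
  innerL2 (fun r => f r + g r) h = innerL2 f h + innerL2 g h.
Proof.
move=> hf hg hh; rewrite !innerL2E//; last exact: L2D.
have -> : reF (fun r => f r + g r) = fun r => reF f r + reF g r.
  by apply/funext => r; exact: Re_addE.
have -> : imF (fun r => f r + g r) = fun r => imF f r + imF g r.
  by apply/funext => r; exact: Im_addE.
move/L2P : hf => [f1 f2]; move/L2P : hg => [g1 g2]; move/L2P : hh => [h1 h2].
by apply: eqC; rewrite ?Re_addE ?Im_addE /= !ripDl//; ring.
Qed.

Lemma innerL2Zl (c : C) f g : L2 f -> L2 g ->
  innerL2 (fun r => c * f r) g = c * innerL2 f g.
Proof.
move=> hf hg; rewrite !innerL2E//; last exact: L2Z.
have -> : reF (fun r => c * f r) = fun r => complex.Re c * reF f r - complex.Im c * imF f r.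
  by apply/funext => r; exact: Re_mulE.
have -> : imF (fun r => c * f r) = fun r => complex.Re c * imF f r + complex.Im c * reF f r.
  by apply/funext => r; exact: Im_mulE.
move/L2P : hf => [f1 f2]; move/L2P : hg => [g1 g2].
have z1 (x : R) := RL2Z x f1; have z2 (x : R) := RL2Z x f2.
rewrite !(ripBl (z1 _) (z2 _))// !(ripDl (z2 _) (z1 _))// !ripZl//.
by apply: eqC; rewrite ?Re_mulE ?Im_mulE /=; ring.
Qed.

Lemma innerL2_suml (I : Type) (s : seq I) (c : I -> C) (f : I -> R -> C) g :
  (forall i, L2 (f i)) -> L2 g ->
  innerL2 (fun r => \sum_(i <- s) c i * f i r) g = \sum_(i <- s) c i * innerL2 (f i) g.
Proof.
move=> hf hg; elim: s => [|i s IH].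
  rewrite big_nil (_ : (fun _ => _) = fun r => 0 * g r).
    by rewrite innerL2Zl// mul0r.
  by apply/funext => r; rewrite big_nil mul0r.
rewrite big_cons -IH -innerL2Zl//.
rewrite -innerL2Dl//; [|exact: L2Z|exact: L2_sum].
by congr innerL2; apply/funext => r; rewrite big_cons.
Qed.

Lemma innerL2_sumr (I : Type) (s : seq I) (c : I -> C) (f : I -> R -> C) g :
  (forall i, L2 (f i)) -> L2 g ->
  innerL2 g (fun r => \sum_(i <- s) c i * f i r) =
  \sum_(i <- s) (c i)^*%R * innerL2 g (f i).
Proof.
move=> hf hg; rewrite (innerL2_conj (L2_sum s c hf) hg) innerL2_suml// rmorph_sum.
by apply: eq_bigr => i _; rewrite rmorphM /= -innerL2_conj.
Qed.

Lemma innerL2Zr (c : C) f g : L2 f -> L2 g ->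
  innerL2 f (fun r => c * g r) = c^*%R * innerL2 f g.
Proof.
move=> hf hg; rewrite (innerL2_conj (L2Z c hg) hf) innerL2Zl// rmorphM /=.
by rewrite -innerL2_conj.
Qed.

Lemma innerL2_self f : L2 f -> innerL2 f f = (fine (sqnormL2 f))%:C%C /\ 0 <= innerL2 f f.
Proof.
move=> hf; have [f1 f2] := (L2P f).1 hf.
have E : innerL2 f f = (fine (sqnormL2 f))%:C%C.
  rewrite innerL2E// [rip (imF f) (reF f)]ripC subrr; congr Complex.
  rewrite /rip -RintegralD//; try exact: RL2_integrable.
split=> //; rewrite E ler0c fine_ge0// /sqnormL2 integral_ge0// => r _.
by rewrite lee_fin addr_ge0 ?sqr_ge0.
Qed.

Lemma innerL2_eq0 f : L2 f -> innerL2 f f = 0 ->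
  {ae mu, forall r : R, Rpos r -> f r = 0}.
Proof.
move=> hf; have [h _] := innerL2_self hf; have [m1 m2 fin] := hf.
rewrite h => -[h0].
have s0 : sqnormL2 f = 0%E.
  have ge0 : (0 <= sqnormL2 f)%E.
    by apply: integral_ge0 => r _; rewrite lee_fin addr_ge0 ?sqr_ge0.
  rewrite -[LHS]fineK ?h0// ge0_fin_numE//.
pose N r : \bar R := (reF f r ^+ 2 + imF f r ^+ 2)%:E.
have mN : measurable_fun Rpos N.
  by apply/measurable_EFinP; apply: measurable_funD; exact: measurable_funX.
have : ae_eq mu Rpos N (cst 0%E).
  apply/ae_eq_integral_abs => //; rewrite -[RHS]s0; apply: eq_integral => r _.
  by rewrite /N abse_EFin ger0_norm// addr_ge0 ?sqr_ge0.
apply: filterS => r + rpos => /(_ rpos) [] /eqP.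
rewrite paddr_eq0 ?sqr_ge0// !sqrf_eq0 => /andP[/eqP hr /eqP hi].
exact: eqC.
Qed.

(** The extended-real norm of the difference is the finite sum [N n] of two nonnegative terms, and
    each of them is squeezed between 0 and [N n]. *)
Lemma cvgL2_rip (f_ : nat -> R -> C) f : L2 f -> (forall n, L2 (f_ n)) -> cvgL2 f_ f ->
  (fun n => rip (fun r => reF (f_ n) r - reF f r) (fun r => reF (f_ n) r - reF f r)) @ \oo --> 0 /\
  (fun n => rip (fun r => imF (f_ n) r - imF f r) (fun r => imF (f_ n) r - imF f r)) @ \oo --> 0.
Proof.
move=> hf hf_ cf; have [f1 f2] := (L2P f).1 hf.
have B1 n := RL2B ((L2P (f_ n)).1 (hf_ n)).1 f1.
have B2 n := RL2B ((L2P (f_ n)).1 (hf_ n)).2 f2.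
pose N n := rip (fun r => reF (f_ n) r - reF f r) (fun r => reF (f_ n) r - reF f r) +
  rip (fun r => imF (f_ n) r - imF f r) (fun r => imF (f_ n) r - imF f r).
have EN n : sqnormL2 (fun r => f_ n r - f r) = (N n)%:E.
  rewrite /N EFinD !EFin_rip// /sqnormL2 -ge0_integralD//.
  - by apply: eq_integral => r _; rewrite -EFinD /reF /imF Re_addE Im_addE Re_oppE Im_oppE.
  - by move=> r _; rewrite lee_fin sqr_ge0.
  - by apply/measurable_EFinP; apply: measurable_funX; case: (B1 n).
  - by move=> r _; rewrite lee_fin sqr_ge0.
  - by apply/measurable_EFinP; apply: measurable_funX; case: (B2 n).
have cN : N @ \oo --> 0.
  have /fine_cvgP[_] := cf; rewrite (_ : fine \o _ = N)//.
  by apply/funext => n /=; rewrite EN.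
split; apply: (@squeeze_cvgr _ _ _ _ (fun=> 0) N) => //; try exact: cvg_cst.
- by near=> n; rewrite rip_ge0 /= lerDl rip_ge0.
- by near=> n; rewrite rip_ge0 /= lerDr rip_ge0.
Unshelve. all: by end_near. Qed.

Lemma innerL2_cvg (f_ g_ : nat -> R -> C) f g : L2 f -> L2 g ->
  (forall n, L2 (f_ n)) -> (forall n, L2 (g_ n)) -> cvgL2 f_ f -> cvgL2 g_ g ->
  (fun n => complex.Re (innerL2 (f_ n) (g_ n))) @ \oo --> complex.Re (innerL2 f g) /\
  (fun n => complex.Im (innerL2 (f_ n) (g_ n))) @ \oo --> complex.Im (innerL2 f g).
Proof.
move=> hf hg hf_ hg_ cf cg.
have [cf1 cf2] := cvgL2_rip hf hf_ cf; have [cg1 cg2] := cvgL2_rip hg hg_ cg.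
have [f1 f2] := (L2P f).1 hf; have [g1 g2] := (L2P g).1 hg.
have f1_ n := ((L2P (f_ n)).1 (hf_ n)).1; have f2_ n := ((L2P (f_ n)).1 (hf_ n)).2.
have g1_ n := ((L2P (g_ n)).1 (hg_ n)).1; have g2_ n := ((L2P (g_ n)).1 (hg_ n)).2.
have E n := innerL2E (hf_ n) (hg_ n).
rewrite (innerL2E hf hg); under eq_fun do rewrite E.
split; last under eq_fun do rewrite E.
- by apply: cvgD; exact: rip_cvg.
- by apply: cvgB; exact: rip_cvg.
Qed.
End ComplexL2.

(** * Negative definite forms on test functions *)

Section HermitianForms.
Local Open Scope sesquilinear_scope.
Variable C : numClosedFieldType.
Implicit Types n : nat.

Definition hform n (H : 'M[C]_n) (c : 'rV[C]_n) : C :=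
  \sum_i \sum_j c 0 i * (c 0 j)^* * H i j.

Definition sqnorm_rv n (c : 'rV[C]_n) : C := \sum_i `|c 0 i| ^+ 2.

Lemma sqnorm_rv_ge0 n (c : 'rV[C]_n) : 0 <= sqnorm_rv c.
Proof. by apply: sumr_ge0 => i _; rewrite exprn_ge0. Qed.

Lemma sqnorm_rv_gt0 n (c : 'rV[C]_n) : c != 0 -> 0 < sqnorm_rv c.
Proof.
move=> c0; rewrite lt_neqAle sqnorm_rv_ge0 andbT eq_sym.
apply: contraNneq c0 => /eqP; rewrite psumr_eq0 => [|i _]; last by rewrite exprn_ge0.
move=> /allP c0; apply/eqP/rowP => i; rewrite mxE.
by have := c0 i (mem_index_enum i); rewrite expf_eq0 /= normr_eq0 => /eqP.
Qed.

Lemma hformB n (H K : 'M[C]_n) c : hform (H - K) c = hform H c - hform K c.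
Proof.
rewrite /hform -sumrB; apply: eq_bigr => i _; rewrite -sumrB; apply: eq_bigr => j _.
by rewrite !mxE mulrBr.
Qed.

(** Each product [|c_i| |c_j|] is at most the mean of the two squares; summing over both indices
    gives the factor [n]. *)
Lemma hform_perturb n (E : 'M[C]_n) (e : C) c : (forall i j, `|E i j| <= e) ->
  `|hform E c| <= e * n%:R * sqnorm_rv c.
Proof.
move=> hE.
have key (i j : 'I_n) : `|c 0 i * (c 0 j)^* * E i j| <=
    e / 2 * (`|c 0 i| ^+ 2 + `|c 0 j| ^+ 2).
  rewrite !normrM norm_conjC; set x := `|c 0 i|; set y := `|c 0 j|.
  have x0 : 0 <= x by exact: normr_ge0.
  have y0 : 0 <= y by exact: normr_ge0.
  have e0 : 0 <= e by apply: le_trans (hE i j).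
  apply: (@le_trans _ _ (x * y * e)); first by rewrite ler_wpM2l ?mulr_ge0.
  rewrite -subr_ge0 (_ : _ - _ = e / 2 * (x - y) ^+ 2); last by field.
  by rewrite mulr_ge0 ?divr_ge0// real_exprn_even_ge0// realB ?ger0_real.
apply: le_trans (ler_norm_sum _ _ _) _.
apply: (@le_trans _ _ (\sum_i \sum_j e / 2 * (`|c 0 i| ^+ 2 + `|c 0 j| ^+ 2))).
  apply: ler_sum => i _; apply: le_trans (ler_norm_sum _ _ _) _.
  by apply: ler_sum => j _; exact: key.
under eq_bigr do rewrite -mulr_sumr big_split /= sumr_const card_ord -/(sqnorm_rv c).
rewrite -mulr_sumr big_split /= sumr_const card_ord sumrMnl -/(sqnorm_rv c).
rewrite -(mulr_natr (sqnorm_rv c)).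
by rewrite le_eqVlt; apply/orP; left; apply/eqP; field.
Qed.

(** Diagonalising by a unitary matrix makes the form a weighted sum of squares with positive
    weights, while [sqnorm_rv] is preserved. This margin is what lets definiteness survive the
    approximation of eigenfunctions. *)
Lemma hermitian_coercive n (H : 'M[C]_n) : (forall i j, H i j = (H j i)^*) ->
  (forall c, c != 0 -> 0 < hform H c) ->
  exists2 d : C, 0 < d & forall c, d * sqnorm_rv c <= hform H c.
Proof.
move=> herm pos.
pose P := spectralmx H; pose D := spectral_diag H.
have Pu : P \is unitarymx by exact: spectral_unitarymx.
have PP : P *m P^t* = 1%:M by exact/unitarymxP.
have PtP : P^t* *m P = 1%:M by rewrite -(invmx_unitary Pu) mulVmx ?unitarymx_unit.
have HE : H = P^t* *m diag_mx D *m P.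
  rewrite -(invmx_unitary Pu); apply/orthomx_spectralP/normalmxP.
  have <- // : H = H^t*; apply/matrixP => i j; rewrite !mxE; exact: herm.
have hformE c : hform H c = \sum_i D 0 i * `|(c *m P^t*) 0 i| ^+ 2.
  transitivity ((c *m H *m c^t*) 0 0).
    rewrite mxE; under [RHS]eq_bigr do rewrite !mxE mulr_suml.
    rewrite exchange_big /=; apply: eq_bigr => i _; apply: eq_bigr => j _.
    by rewrite mulrAC.
  have -> : c *m H *m c^t* = (c *m P^t*) *m diag_mx D *m (c *m P^t*)^t*.
    by rewrite HE trmx_mul map_mxM trmxCK !mulmxA.
  rewrite mul_mx_diag mxE; apply: eq_bigr => i _; rewrite !mxE normCK.
  by rewrite mulrAC mulrC.
have sqnormE c : sqnorm_rv c = sqnorm_rv (c *m P^t*).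
  have sE (z : 'rV[C]_n) : sqnorm_rv z = (z *m z^t*) 0 0.
    by rewrite mxE; apply: eq_bigr => i _; rewrite !mxE normCK.
  by rewrite !sE trmx_mul map_mxM trmxCK !mulmxA -(mulmxA c) PtP mulmx1.
(* The [i]-th row of [P] has [i]-th unit vector as its coordinates, so the form at that row is the
   eigenvalue [D 0 i]. *)
have D0 i : 0 < D 0 i.
  have rP : row i P *m P^t* = delta_mx 0 i by rewrite -row_mul PP row1.
  have r0 : row i P != 0.
    apply: contra_eq_neq rP => ->; rewrite mul0mx eq_sym.
    by apply/eqP => /matrixP /(_ 0 i); rewrite !mxE !eqxx => /eqP; rewrite oner_eq0.
  have := pos _ r0; rewrite hformE rP (bigD1 i)//= big1 ?addr0.
    by rewrite mxE !eqxx normr1 expr1n mulr1.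
  by move=> j ji; rewrite mxE (negbTE ji) andbF normr0 expr0n mulr0.
(* [S] exceeds every [1 / D 0 i], so [S^-1] lies below all eigenvalues without choosing a minimum;
   the 1 covers [n = 0]. *)
pose S := 1 + \sum_i (D 0 i)^-1.
have iD0 i : 0 <= (D 0 i)^-1 by rewrite invr_ge0 ltW.
have S0 : 0 < S by rewrite ltr_pwDl// sumr_ge0.
exists S^-1; first by rewrite invr_gt0.
move=> c; rewrite hformE sqnormE mulr_sumr; apply: ler_sum => i _.
rewrite ler_wpM2r ?exprn_ge0// -[leRHS]invrK lef_pV2 ?posrE ?invr_gt0//.
by rewrite /S (bigD1 i)//= addrCA lerDl addr_ge0// sumr_ge0.
Qed.
End HermitianForms.

(** * Compactly supported functions of class C^2 *)

Section CompactlySupported.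
Context {R : realType}.
Notation mu := (@lebesgue_measure R).
Notation C := R[i].

(** The derivatives are arguments, so linear combinations act on them termwise. Vanishing outside
    the open interval includes [lo] and [hi], which thereby serve as the outer zeros in the interval
    estimate. *)
Record C2on (lo hi : R) (f f1 f2 : R -> R) : Prop := {
  C2on_derive : forall r : R, is_derive r 1 f (f1 r);
  C2on_derive1 : forall r : R, is_derive r 1 f1 (f2 r);
  C2on_continuous2 : continuous f2;
  C2on_support : forall r, ~~ (lo < r < hi) -> f r = 0 /\ f2 r = 0 }.

Lemma C2onD lo hi f f1 f2 g g1 g2 : C2on lo hi f f1 f2 -> C2on lo hi g g1 g2 ->
  C2on lo hi (fun r => f r + g r) (fun r => f1 r + g1 r) (fun r => f2 r + g2 r).
Proof.
case=> df df1 cf sf [dg dg1 cg sg]; split.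
- by move=> r; exact: is_derive_addf.
- by move=> r; exact: is_derive_addf.
- by move=> r; apply: contD; [exact: cf|exact: cg].
- by move=> r hr; have [-> ->] := sf r hr; have [-> ->] := sg r hr; rewrite addr0.
Qed.

Lemma C2onZ (c : R) lo hi f f1 f2 : C2on lo hi f f1 f2 ->
  C2on lo hi (fun r => c * f r) (fun r => c * f1 r) (fun r => c * f2 r).
Proof.
case=> df df1 cf sf; split.
- by move=> r; exact: is_derive_scalef.
- by move=> r; exact: is_derive_scalef.
- by move=> r; apply: contM; [exact: cvg_cst|exact: cf].
- by move=> r hr; have [-> ->] := sf r hr; rewrite mulr0.
Qed.

Lemma C2on_widen lo hi lo' hi' f f1 f2 : lo' <= lo -> hi <= hi' ->
  C2on lo hi f f1 f2 -> C2on lo' hi' f f1 f2.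
Proof.
move=> lo'lo hihi' [df df1 cf sf]; split=> // r hr; apply: sf.
apply: contra hr => /andP[lr rh].
by rewrite (le_lt_trans lo'lo lr) (lt_le_trans rh hihi').
Qed.

Definition CC2on lo hi (u u2 : R -> C) : Prop :=
  (exists f1, C2on lo hi (reF u) f1 (reF u2)) /\
  (exists f1, C2on lo hi (imF u) f1 (imF u2)).

Lemma CC2onD lo hi u u2 w w2 : CC2on lo hi u u2 -> CC2on lo hi w w2 ->
  CC2on lo hi (fun r => u r + w r) (fun r => u2 r + w2 r).
Proof.
have reE (f g : R -> C) : reF (fun r => f r + g r) = fun r => reF f r + reF g r.
  by apply/funext => r; exact: Re_addE.
have imE (f g : R -> C) : imF (fun r => f r + g r) = fun r => imF f r + imF g r.
  by apply/funext => r; exact: Im_addE.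
move=> [[f1 hf] [g1 hg]] [[h1 hh] [k1 hk]]; split.
- by rewrite !reE; eexists; exact: C2onD hf hh.
- by rewrite !imE; eexists; exact: C2onD hg hk.
Qed.

Lemma CC2onZ (c : C) lo hi u u2 : CC2on lo hi u u2 ->
  CC2on lo hi (fun r => c * u r) (fun r => c * u2 r).
Proof.
have reE (f : R -> C) : reF (fun r => c * f r) =
    fun r => complex.Re c * reF f r + - complex.Im c * imF f r.
  by apply/funext => r; rewrite /reF Re_mulE mulNr.
have imE (f : R -> C) : imF (fun r => c * f r) =
    fun r => complex.Re c * imF f r + complex.Im c * reF f r.
  by apply/funext => r; exact: Im_mulE.
move=> [[f1 hf] [g1 hg]]; split.
- by rewrite !reE; eexists; exact: C2onD (C2onZ _ hf) (C2onZ _ hg).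
- by rewrite !imE; eexists; exact: C2onD (C2onZ _ hg) (C2onZ _ hf).
Qed.

Lemma CC2on_sum (I : Type) (s : seq I) (c : I -> C) lo hi (u u2 : I -> R -> C) :
  (forall i, CC2on lo hi (u i) (u2 i)) ->
  CC2on lo hi (fun r => \sum_(i <- s) c i * u i r) (fun r => \sum_(i <- s) c i * u2 i r).
Proof.
move=> hu; elim: s => [|i s IH].
  rewrite (_ : (fun _ => _) = fun=> 0); last by apply/funext => r; rewrite big_nil.
  rewrite [X in CC2on _ _ _ X](_ : _ = fun=> 0); last by apply/funext => r; rewrite big_nil.
  have z : C2on lo hi (fun=> 0) (fun=> 0) (fun=> 0).
    by split=> // r; [exact: is_derive_cst|exact: is_derive_cst|exact: cvg_cst].
  by split; exists (fun=> 0).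
rewrite (_ : (fun _ => _) = fun r => c i * u i r + \sum_(i <- s) c i * u i r); last first.
  by apply/funext => r; rewrite big_cons.
rewrite [X in CC2on _ _ _ X](_ : _ = fun r => c i * u2 i r + \sum_(i <- s) c i * u2 i r); last first.
  by apply/funext => r; rewrite big_cons.
by apply: CC2onD => //; exact: CC2onZ.
Qed.

(** Off the closed interval [[m, M]], an open set, [f] vanishes near each point, so by induction all
    its derivatives vanish there. *)
Lemma smooth_C2on (f : R -> R) (lo hi m M : R) : lo < m -> M < hi -> smooth f ->
  (forall r, ~~ (m <= r <= M) -> f r = 0) ->
  C2on lo hi f (derive1n 1 f) (derive1n 2 f).
Proof.
move=> lom Mhi sf f0.
have D n (x : R) : is_derive x 1 (derive1n n f) (derive1n n.+1 f x).
  by apply: (DeriveDef (sf n x)); rewrite derive1nS derive1E.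
have zero n r : ~~ (m <= r <= M) -> derive1n n f r = 0.
  elim: n r => [|n IH] r hr; first exact: f0.
  have dz : is_derive r 1 (derive1n n f) 0.
    apply: (@near_is_derive _ (cst 0) _ r 0 _ (is_derive_cst (0 : R) r (1 : R))).
    move: hr; rewrite negb_and -!ltNge => /orP[rm|Mr].
      near=> y; rewrite IH// negb_and -ltNge; apply/orP; left.
      by near: y; exact: lt_nbhsl.
    near=> y; rewrite IH// negb_and -!ltNge; apply/orP; right.
    by near: y; exact: lt_nbhsr.
  by rewrite derive1nS; exact: is_derive_derive1 dz.
split.
- exact: D 0%N.
- exact: D 1%N.
- by move=> r; exact: is_derive_continuous (D 2%N r).
- move=> r hr; suff hr' : ~~ (m <= r <= M) by rewrite f0// zero.
  apply: contra hr => /andP[mr rM].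
  by rewrite (lt_le_trans lom mr) (le_lt_trans rM Mhi).
Unshelve. all: by end_near. Qed.

Lemma Ccoo_CC2on (u : R -> C) : Ccoo u ->
  exists lo hi, [/\ 0 < lo, lo < hi & CC2on lo hi u (cderive2 u)].
Proof.
move=> [sre sim cpt sub].
set S := closure _ in cpt sub.
have uS r : ~ S r -> u r = 0.
  by move=> nS; apply/eqP; apply: contrapT => /negP ur; apply: nS; apply: subset_closure.
have [m [M [m0 hM hS]]] : exists m M : R, [/\ 0 < m, m <= M & forall r, S r -> m <= r <= M].
  have [S0|/nonemptyPn S0] := pselect (S !=set0); last first.
    (* The support of the zero function is empty, and any positive bounds will do. *)
    by exists 1, 1; split=> // r; rewrite S0.
  have cid A : {within A, continuous (fun x : R => x)}.
    by apply: continuous_subspaceT => x; exact: cvg_id.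
  have [x Sx hx] := compact_EVT_min S0 cpt (cid S).
  have [y Sy hy] := compact_EVT_max S0 cpt (cid S).
  exists x, y; split; first by move: Sx; rewrite inE => /sub; rewrite RposE.
    exact: hx.
  by move=> r Sr; rewrite hx ?hy ?inE.
have out r : ~~ (m <= r <= M) -> u r = 0.
  by move=> /negP hr; apply: uS => /hS.
exists (m / 2), (M + 1); split; [lra|lra|].
have h1 : m / 2 < m by lra.
have h2 : M < M + 1 by lra.
split; eexists.
- apply: (smooth_C2on h1 h2 sre) => r /out; rewrite /reF => -> //.
- apply: (smooth_C2on h1 h2 sim) => r /out; rewrite /imF => -> //.
Qed.

Lemma Rintegral_support (g : R -> R) (lo hi : R) : 0 < lo ->
  (forall r, ~~ (lo <= r <= hi) -> g r = 0) ->
  (\int[mu]_(r in Rpos) (g r)%:E = \int[mu]_(r in `[lo, hi]) (g r)%:E)%E.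
Proof.
move=> lo0 g0; rewrite [LHS]integral_mkcond [RHS]integral_mkcond.
apply: eq_integral => r _; rewrite !patchE mem_Rpos.
have -> : (r \in `[lo, hi]%classic) = (lo <= r <= hi).
  by apply/idP/idP; rewrite inE /= in_itv.
case: ifPn => r0; case: ifPn => // hr; first by rewrite g0.
by case/andP: hr => lr _; rewrite (lt_le_trans lo0 lr) in r0.
Qed.

Lemma RL2_support (f : R -> R) (lo hi : R) : 0 < lo -> (forall r, 0 < r -> {for r, continuous f}) ->
  (forall r, ~~ (lo <= r <= hi) -> f r = 0) -> RL2 f.
Proof.
move=> lo0 cf f0; split.
  apply: open_continuous_measurable_fun; first exact: interval_open.
  by move=> z; rewrite mem_Rpos; exact: cf.
rewrite (Rintegral_support lo0 (hi := hi)); last first.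
  by move=> r /f0 ->; rewrite expr0n.
have /integrableP[_] : mu.-integrable `[lo, hi] (EFin \o (fun r => f r ^+ 2)).
  apply: integrable_continuous_itv => x /andP[lx _].
  by apply: contX2; apply: cf; exact: lt_le_trans lx.
by under eq_integral do rewrite /= ger0_norm ?sqr_ge0//.
Qed.
End CompactlySupported.

(** * The radial operator and its quadratic form *)

Section RadialForm.
Context {R : realType}.
Notation mu := (@lebesgue_measure R).
Notation C := R[i].
Variables (ca cb : R) (V : R -> R).
Hypothesis cV : forall r, 0 < r -> {for r, continuous V}.

Definition radial_real (f f2 : R -> R) (r : R) : R :=
  - f2 r + ca / r ^+ 2 * f r + cb * r ^+ 2 * f r + V r * f r.

(** With the second derivative as a separate argument the expression is linear in the pair
    [(u, u2)]; at [u2 = cderive2 u] it is [radial_expr] by conversion. *)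
Definition radial_cplx (u u2 : R -> C) (r : R) : C :=
  - u2 r + (ca / r ^+ 2)%:C%C * u r + (cb * r ^+ 2)%:C%C * u r + (V r)%:C%C * u r.

Lemma radial_cplx_sum (I : Type) (s : seq I) (c : I -> C) (u u2 : I -> R -> C) :
  radial_cplx (fun r => \sum_(i <- s) c i * u i r) (fun r => \sum_(i <- s) c i * u2 i r) =
  fun r => \sum_(i <- s) c i * radial_cplx (u i) (u2 i) r.
Proof.
apply/funext => r; rewrite /radial_cplx !mulr_sumr -sumrN -!big_split /=.
by apply: eq_bigr => i _; ring.
Qed.

Lemma reF_radial (u u2 : R -> C) : reF (radial_cplx u u2) = radial_real (reF u) (reF u2).
Proof.
apply/funext => r; rewrite /reF /radial_real /radial_cplx !Re_addE Re_oppE !Re_mulE /=.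
by rewrite !mul0r !subr0.
Qed.

Lemma imF_radial (u u2 : R -> C) : imF (radial_cplx u u2) = radial_real (imF u) (imF u2).
Proof.
apply/funext => r; rewrite /imF /radial_real /radial_cplx !Im_addE Im_oppE !Im_mulE /=.
by rewrite !mul0r !addr0.
Qed.

Lemma radial_real_continuous lo hi f f1 f2 (r : R) : C2on lo hi f f1 f2 -> 0 < r ->
  {for r, continuous (radial_real f f2)}.
Proof.
move=> [df df1 cf2 _] r0; have cf := is_derive_continuous (df r).
have c2 : {for r, continuous (fun x : R => x ^+ 2)} by exact: exprn_continuous.
apply: contD; last by apply: contM => //; exact: cV.
apply: contD; last by apply: contM => //; apply: contM => //; exact: cvg_cst.
apply: contD; first by apply: contN; exact: cf2.
apply: contM => //; apply: contM; first exact: cvg_cst.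
by apply: contV => //; rewrite expf_neq0 ?gt_eqF.
Qed.

Lemma C2on_RL2 lo hi (f f1 f2 : R -> R) : 0 < lo -> C2on lo hi f f1 f2 ->
  RL2 f /\ RL2 (radial_real f f2).
Proof.
move=> lo0 hf; have [df _ _ sf] := hf.
have out r : ~~ (lo <= r <= hi) -> ~~ (lo < r < hi).
  by apply: contra => /andP[lr rh]; rewrite !ltW.
split; apply: (RL2_support lo0 (hi := hi)).
- by move=> r _; exact: is_derive_continuous (df r).
- by move=> r /out /sf[].
- by move=> r; exact: radial_real_continuous hf.
- by move=> r /out /sf[fr f2r]; rewrite /radial_real fr f2r oppr0 !mulr0 !addr0.
Qed.

Lemma CC2on_L2 lo hi (u u2 : R -> C) : 0 < lo -> CC2on lo hi u u2 ->
  L2 u /\ L2 (radial_cplx u u2).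
Proof.
move=> lo0 [[f1 /(C2on_RL2 lo0)[hf hAf]] [g1 /(C2on_RL2 lo0)[hg hAg]]].
by split; apply/L2P => //; rewrite reF_radial imF_radial.
Qed.

(** A pointwise identity: [ca = alpha + (ca - alpha)], the second part being moved into [Q]. *)
Lemma rip_radial alpha (Q : R -> R) lo hi (f f1 f2 : R -> R) : 0 < lo ->
  (forall r, 0 < r -> Q r = (ca - alpha) / r ^+ 2 + cb * r ^+ 2 + V r) ->
  C2on lo hi f f1 f2 ->
  rip (radial_real f f2) f = \int[mu]_(r in `[lo, hi]) radial_density alpha Q f f2 r.
Proof.
move=> lo0 hQ hf; have [_ _ _ sf] := hf.
rewrite /rip /Rintegral (Rintegral_support lo0 (hi := hi)).
  congr fine; apply: eq_integral => r; rewrite inE /= in_itv /= => /andP[lr _].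
  have r0 : 0 < r by exact: lt_le_trans lr.
  rewrite /radial_real /radial_density hQ//; congr EFin; field; rewrite gt_eqF//.
move=> r hr; have hr' : ~~ (lo < r < hi).
  by apply: contra hr => /andP[lr rh]; rewrite !ltW.
by have [-> _] := sf r hr'; rewrite mulr0.
Qed.
End RadialForm.

(** * Counting eigenvalues *)

Section EigenvalueBound.
Context {R : realType}.
Notation mu := (@lebesgue_measure R).
Notation C := R[i].

Lemma exists_kernel_row (F : fieldType) (n m : nat) (M : 'M[F]_(n, m)) : (m < n)%N ->
  exists2 c : 'rV[F]_n, c != 0 & c *m M = 0.
Proof.
move=> mn; have K0 : kermx M != 0.
  by rewrite -mxrank_eq0 mxrank_ker -lt0n subn_gt0 (leq_ltn_trans (rank_leq_col M)).
have [i hi] : exists i, row i (kermx M) != 0.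
  apply/existsP; apply: contraNT K0 => /existsPn h; apply/eqP/row_matrixP => i.
  by rewrite row0; apply/eqP; rewrite -[_ == _]negbK; exact: h.
by exists (row i (kermx M)) => //; rewrite -row_mul mulmx_ker row0.
Qed.

Lemma common_interval (n : nat) (u u2 : 'I_n -> R -> C) :
  (forall i, exists lo hi, [/\ 0 < lo, lo < hi & CC2on lo hi (u i) (u2 i)]) ->
  exists lo hi, [/\ 0 < lo, lo < hi & forall i, CC2on lo hi (u i) (u2 i)].
Proof.
move=> /choice[lo_ /choice[hi_ h]].
(* [S] dominates every [hi_ i] and every [1 / lo_ i], so the interval from [1 / (S + 2)] to [S + 2]
   contains all supports; the 2 keeps it nonempty even when there are no functions. *)
pose S := \sum_i ((lo_ i)^-1 + hi_ i).
have p i : 0 < (lo_ i)^-1 /\ 0 < hi_ i.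
  by have [l0 lh _] := h i; rewrite invr_gt0 l0 (lt_trans l0 lh).
have S0 : 0 <= S by apply: sumr_ge0 => i _; have [? ?] := p i; rewrite addr_ge0 ?ltW.
have S1 i : (lo_ i)^-1 + hi_ i <= S.
  rewrite /S (bigD1 i)//= lerDl; apply: sumr_ge0 => j _.
  by have [? ?] := p j; rewrite addr_ge0 ?ltW.
have S2 : 0 < S + 2 by lra.
exists (S + 2)^-1, (S + 2); split.
- by rewrite invr_gt0.
- by rewrite -[ltLHS]mulr1 ltr_pdivrMl// -expr2 -[ltLHS](expr1n _ 2) ltr_pXn2r ?nnegrE//; lra.
- move=> i; have [l0 _ [[f1 hf] [g1 hg]]] := h i; have [p1 p2] := p i; have Si := S1 i.
  have l1 : (S + 2)^-1 <= lo_ i by rewrite -[leRHS]invrK lef_pV2 ?posrE ?invr_gt0//; lra.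
  have l2 : hi_ i <= S + 2 by lra.
  by split; eexists; [exact: C2on_widen l1 l2 hf|exact: C2on_widen l1 l2 hg].
Qed.

Section Gram.
Variables (n : nat) (f : 'I_n -> R -> C) (lam : 'I_n -> R).
Hypothesis f_L2 : forall i, L2 (f i).
Hypothesis lam_lt0 : forall i, lam i < 0.
Hypothesis f_orth : forall i j, lam i != lam j -> innerL2 (f i) (f j) = 0.
Hypothesis f_indep : forall (x : R) (c : 'I_n -> C),
  {ae mu, forall r : R, Rpos r -> \sum_i (if lam i == x then c i else 0) * f i r = 0} ->
  forall i, lam i = x -> c i = 0.

Let gram (c : 'I_n -> C) : C := \sum_i \sum_j c i * (c j)^* * innerL2 (f i) (f j).

Let gramE c : gram c = innerL2 (fun r => \sum_i c i * f i r) (fun r => \sum_i c i * f i r).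
Proof.
rewrite innerL2_suml//; last exact: L2_sum.
apply: eq_bigr => i _; rewrite innerL2_sumr// mulr_sumr.
by apply: eq_bigr => j _; rewrite mulrA.
Qed.

Let gram_ge0 c : 0 <= gram c.
Proof. by rewrite gramE; have [] := innerL2_self (L2_sum (index_enum _) c f_L2). Qed.

(** Independence is assumed only inside each eigenvalue. The coefficients are split into the block
    of [lam i0] and the rest; orthogonality removes the cross terms, the block is positive by
    independence, the rest nonnegative. *)
Let gram_gt0 c i0 : c i0 != 0 -> 0 < gram c.
Proof.
move=> c0; pose x := lam i0.
pose b i := if lam i == x then c i else 0.
pose d i := if lam i == x then 0 else c i.
have -> : gram c = gram b + gram d.
  rewrite /gram -big_split /=; apply: eq_bigr => i _; rewrite -big_split /=.
  apply: eq_bigr => j _; rewrite /b /d.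
  have [ix|ix] := eqVneq (lam i) x; have [jx|jx] := eqVneq (lam j) x.
  - by rewrite !mul0r addr0.
  - by rewrite f_orth ?ix 1?eq_sym// !mulr0 addr0.
  - by rewrite f_orth ?jx// !mulr0 addr0.
  - by rewrite !mul0r add0r.
rewrite ltr_pwDl// lt_neqAle gram_ge0 andbT eq_sym.
apply: contra c0 => /eqP; rewrite gramE => h.
by rewrite (f_indep (x := x) (c := c) (innerL2_eq0 (L2_sum (index_enum _) b f_L2) h)).
Qed.

(* By orthogonality [-lam i <f i, f j> = s i s j <f i, f j>], [s i = sqrt (- lam i)]. *)
Lemma eigen_form_gt0 (c : 'rV[C]_n) : c != 0 ->
  0 < hform (\matrix_(i, j) - ((lam i)%:C%C * innerL2 (f i) (f j))) c.
Proof using f_L2 lam_lt0 f_orth f_indep.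
move=> c0; pose s i : C := (Num.sqrt (- lam i))%:C%C.
have s0 i : s i != 0.
  by rewrite eq_complex /= eqxx andbT sqrtr_eq0 -ltNge oppr_gt0 lam_lt0.
have sJ i : (s i)^* = s i by rewrite conjC_complexE /= oppr0.
have -> : hform (\matrix_(i, j) - ((lam i)%:C%C * innerL2 (f i) (f j))) c =
    gram (fun i => c 0 i * s i).
  apply: eq_bigr => i _; apply: eq_bigr => j _; rewrite mxE.
  have [ij|ij] := eqVneq (lam i) (lam j); last by rewrite f_orth// !mulr0 oppr0 mulr0.
  rewrite rmorphM /= sJ; have -> : s j = s i by rewrite /s ij.
  have ss : s i * s i = - (lam i)%:C%C.
    by rewrite /s -rmorphM /= -expr2 sqr_sqrtr ?oppr_ge0 ?ltW// rmorphN.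
  by rewrite mulrACA ss; ring.
have [i0 ci0] : exists i, c 0 i != 0.
  apply/existsP; apply: contraNT c0 => /existsPn h; apply/eqP/rowP => i.
  by rewrite mxE; apply/eqP; rewrite -[_ == _]negbK; exact: h.
by apply: (gram_gt0 (i0 := i0)); rewrite mulf_neq0.
Qed.
End Gram.

Section Bound.
Variables (ca cb alpha k : R) (F V Qm : R -> R).
Hypotheses (halpha : 0 < alpha + 1 / 4) (hk : 1 < k).
Hypothesis dF : forall t : R, -2 < t < 2 -> is_derive t 1 F (soliton k t).
Hypothesis F01 : F 0 < F 1.
Hypothesis cV : forall r, 0 < r -> {for r, continuous V}.
Let Q (r : R) : R := (ca - alpha) / r ^+ 2 + cb * r ^+ 2 + V r.
Hypothesis Qm0 : forall r, 0 < r -> 0 <= Qm r.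
Hypothesis QQm : forall r, 0 < r -> - Qm r <= Q r.
Hypothesis hi : mu.-integrable Rpos (EFin \o mass_density k Qm).

Let G := closure_op (radial_op ca cb V).
Let K := young_const k (alpha + 1 / 4).
Let c0 : R := 4 * Num.sqrt (alpha + 1 / 4) * (F 1 - F 0).

Let cQ r : 0 < r -> {for r, continuous Q}.
Proof.
move=> r0; have c2 : {for r, continuous (fun x : R => x ^+ 2)} by exact: exprn_continuous.
apply: contD; last exact: cV.
apply: contD; last by apply: contM => //; exact: cvg_cst.
apply: contM; first exact: cvg_cst.
by apply: contV => //; rewrite expf_neq0 ?gt_eqF.
Qed.

Let mass_le (lo hi' : R) : 0 < lo ->
  K * \int[mu]_(r in `[lo, hi']) mass_density k Qm r <=
  K * \int[mu]_(r in Rpos) mass_density k Qm r.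
Proof.
move=> lo0; rewrite ler_wpM2l ?(ltW (young_const_gt0 hk halpha))//.
have sub : `[lo, hi']%classic `<=` (Rpos : set R).
  by move=> r; rewrite RposE /= in_itv /= => /andP[lr _]; exact: lt_le_trans lr.
have h0 r : Rpos r -> (0 <= (mass_density k Qm r)%:E)%E.
  by rewrite RposE => r0; rewrite lee_fin mulr_ge0 ?powR_ge0.
apply: fine_le.
- by apply: integrable_fin_num => //; exact: integrableS hi.
- exact: integrable_fin_num.
- by apply: ge0_subset_integral => //; exact: measurable_int hi.
Qed.

(* A nonzero element of an [n]-dimensional span can be made to vanish at
   [n - 1] prescribed points; there the form is nonnegative. *)
Lemma eigenfamily_bound (n : nat) (f : 'I_n -> R -> C) (lam : 'I_n -> R) :
  self_adjoint G ->
  (forall i, lam i < 0) ->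
  (forall i, G (f i, fun r => (lam i)%:C%C * f i r)) ->
  (forall (x : R) (c : 'I_n -> C),
    {ae mu, forall r : R, Rpos r -> \sum_i (if lam i == x then c i else 0) * f i r = 0} ->
    forall i, lam i = x -> c i = 0) ->
  n%:R * c0 <= K * \int[mu]_(r in Rpos) mass_density k Qm r.
Proof.
move=> [_ Gadj] lam0 Gf f_indep; rewrite leNgt; apply/negP => hn.
case: n => [|n] in f lam lam0 Gf f_indep hn *.
  suff : 0 <= K * \int[mu]_(r in Rpos) mass_density k Qm r.
    by rewrite leNgt -[X in _ < X](mul0r c0) hn.
  rewrite mulr_ge0 ?(ltW (young_const_gt0 hk halpha))// Rintegral_ge0// => r; rewrite RposE => r0.
  by rewrite mulr_ge0 ?powR_ge0.
have f_L2 i : L2 (f i) by case: (Gf i).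
have Af_L2 i : L2 (fun r => (lam i)%:C%C * f i r) by exact: L2Z.
(* Self-adjointness enters here: the pair of [f j] lies in the graph of the adjoint and is tested
   against the pair of [f i]. *)
have sym i j : (lam i)%:C%C * innerL2 (f i) (f j) = (lam j)%:C%C * innerL2 (f i) (f j).
  have : adjoint_op G (f j, fun r => (lam j)%:C%C * f j r) by rewrite Gadj.
  move=> [_ _ /(_ _ _ (Gf i))] /=; rewrite innerL2Zl// innerL2Zr// => ->.
  by rewrite conjC_complexE /= oppr0.
have f_orth i j : lam i != lam j -> innerL2 (f i) (f j) = 0.
  move=> ij; have /eqP := sym i j; rewrite -subr_eq0 -mulrBl mulf_eq0 => /orP[|/eqP//].
  by rewrite -rmorphB /= eq_complex /= subr_eq0 (negbTE ij).
pose H : 'M[C]_n.+1 := \matrix_(i, j) - ((lam i)%:C%C * innerL2 (f i) (f j)).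
have herm i j : H i j = (H j i)^*.
  rewrite !mxE rmorphN rmorphM /= -innerL2_conj// conjC_complexE /= oppr0.
  by rewrite sym.
have pos c : c != 0 -> 0 < hform H c by exact: eigen_form_gt0.
have [d d0 hd] := hermitian_coercive herm pos.
(* Membership in the closure gives test functions [u] with [u -> f i] and [A u -> lam i f i]
   simultaneously, so the matrix of the form on them tends to [H]. *)
have /choice[u_ hu] : forall i, exists u : nat -> R -> C, [/\ forall m, Ccoo (u m),
    cvgL2 u (f i) & cvgL2 (fun m => radial_expr ca cb V (u m)) (fun r => (lam i)%:C%C * f i r)].
  move=> i; have [_ _ [u [v [hG cu cv]]]] := Gf i.
  have huv m : Ccoo (u m) /\ v m = radial_expr ca cb V (u m).
    by have [w hw [<- <-]] := hG m.
  exists u; split=> // [m|]; first by have [] := huv m.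
  by rewrite (_ : (fun m => _) = v)//; apply/funext => m; have [_ ->] := huv m.
have u_CC i m : exists lo hi, [/\ 0 < lo, lo < hi & CC2on lo hi (u_ i m) (cderive2 (u_ i m))].
  by apply: Ccoo_CC2on; have [h _ _] := hu i.
have u_L2 i m : L2 (u_ i m) /\ L2 (radial_expr ca cb V (u_ i m)).
  by have [lo [hi' [lo0 _ h]]] := u_CC i m; exact: (CC2on_L2 ca cb cV lo0 h).
have d_re : d = (complex.Re d)%:C%C.
  by apply: eqC => //=; move: d0; rewrite ltcE => /andP[/eqP].
have d'0 : 0 < complex.Re d by move: d0; rewrite ltcE => /andP[].
(* An entrywise error [e] changes the form by at most [e n.+1 = d / 2] times the squared norm, which
   is below the coercivity margin [d]. *)
pose e : R := complex.Re d / (2 * n.+1%:R).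
have e0 : 0 < e by rewrite divr_gt0// mulr_gt0.
pose Hm m : 'M[C]_n.+1 :=
  \matrix_(i, j) - innerL2 (radial_expr ca cb V (u_ i m)) (u_ j m).
have [m hm] : exists m, forall i j, `|(H - Hm m) i j| <= e%:C%C.
  have near_ij (ij : 'I_n.+1 * 'I_n.+1) : \forall m \near \oo,
      `|(H - Hm m) ij.1 ij.2| <= e%:C%C.
    case: ij => i j /=.
    have [_ cui cAui] := hu i; have [_ cuj _] := hu j.
    have [cre cim] := innerL2_cvg (Af_L2 i) (f_L2 j) (fun m => (u_L2 i m).2)
      (fun m => (u_L2 j m).1) cAui cuj.
    (* Errors at most [e / 2] in the real and imaginary parts give a modulus at most
       [e / sqrt 2]. *)
    have e2 : 0 < e / 2 by rewrite divr_gt0.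
    near=> m; rewrite !mxE opprK addrC -innerL2Zl//.
    have hre : `|complex.Re (innerL2 (fun r => (lam i)%:C%C * f i r) (f j)) -
        complex.Re (innerL2 (radial_expr ca cb V (u_ i m)) (u_ j m))| <= e / 2.
      by near: m; exact: cvgr_dist_le cre _ e2.
    have him : `|complex.Im (innerL2 (fun r => (lam i)%:C%C * f i r) (f j)) -
        complex.Im (innerL2 (radial_expr ca cb V (u_ i m)) (u_ j m))| <= e / 2.
      by near: m; exact: cvgr_dist_le cim _ e2.
    rewrite distrC normc_def lecR !Re_addE !Im_addE !Re_oppE !Im_oppE.
    rewrite -[leRHS](gtr0_norm e0) -sqrtr_sqr ler_wsqrtr//.
    have := lerD (lerXn2r 2 (normr_ge0 _) (ltW e2) hre) (lerXn2r 2 (normr_ge0 _) (ltW e2) him).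
    rewrite !real_normK ?num_real// => /le_trans; apply.
    by have := sqr_ge0 e; rewrite (_ : (e / 2) ^+ 2 = e ^+ 2 / 4); [lra|field].
  have [N _ hN] := filter_forall _ near_ij.
  by exists N => i j; exact: (hN N (leqnn N) (i, j)).
have [lo [hi' [lo0 lohi hu2]]] := common_interval (fun i => u_CC i m).
have hi_sub : mu.-integrable `[lo, hi'] (EFin \o mass_density k Qm).
  apply: integrableS hi => // r; rewrite RposE /= in_itv /= => /andP[lr _].
  exact: lt_le_trans lr.
have hmass : K * \int[mu]_(r in `[lo, hi']) mass_density k Qm r <= n.+1%:R * c0.
  exact: le_trans (mass_le hi' lo0) (ltW hn).
have [s [ss hs]] := split_form_ge0 halpha hk dF cQ Qm0 QQm lo0 lohi hi_sub F01 hmass.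
(* Values of the [n.+1] test functions at the [n] cuts: more rows than columns, so some nonzero
   combination [phi] vanishes at all cuts. *)
pose M : 'M[C]_(n.+1, size s) := \matrix_(i, j) u_ i m (s`_j).
have [c cN0 cM] : exists2 c : 'rV[C]_n.+1, c != 0 & c *m M = 0.
  by apply: exists_kernel_row; rewrite ss.
pose phi r := \sum_i c 0 i * u_ i m r.
pose phi2 r := \sum_i c 0 i * cderive2 (u_ i m) r.
have phis t : t \in s -> phi t = 0.
  move=> ts; have hj : (index t s < size s)%N by rewrite index_mem.
  have /rowP /(_ (Ordinal hj)) := cM; rewrite !mxE => <-.
  by apply: eq_bigr => i _; rewrite mxE /= nth_index.
have hphi : CC2on lo hi' phi phi2 by apply: CC2on_sum => i; exact: hu2.
have [phiL2 AphiL2] := CC2on_L2 ca cb cV lo0 hphi.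
have form : 0 <= complex.Re (innerL2 (radial_cplx ca cb V phi phi2) phi).
  have part (g g1 g2 : R -> R) : C2on lo hi' g g1 g2 -> (forall t, t \in s -> g t = 0) ->
      0 <= rip (radial_real ca cb V g g2) g.
    move=> hg gs; rewrite (rip_radial (Q := Q) (alpha := alpha) lo0 _ hg)//.
    have [dg dg1 cg sg] := hg; apply: hs dg dg1 cg _ _ gs.
      by have [] := sg lo; rewrite ?ltxx.
    by have [] := sg hi'; rewrite ?ltxx ?andbF.
  rewrite innerL2E//= reF_radial imF_radial.
  have [[g1 hg] [h1 hh]] := hphi.
  rewrite addr_ge0 ?(part _ _ _ hg) ?(part _ _ _ hh)// => t /phis.
    by rewrite /reF => ->.
  by rewrite /imF => ->.
have Hmc : hform (Hm m) c = - innerL2 (radial_cplx ca cb V phi phi2) phi.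
  rewrite radial_cplx_sum innerL2_suml//; last by move=> i; have [] := u_L2 i m.
  rewrite -sumrN; apply: eq_bigr => i _.
  rewrite innerL2_sumr; [|by move=> j; have [] := u_L2 j m|by have [] := u_L2 i m].
  rewrite mulr_sumr -sumrN; apply: eq_bigr => j _.
  by rewrite mxE mulrN mulrA.
have N0 : 0 < sqnorm_rv c by exact: sqnorm_rv_gt0.
have D := hform_perturb c hm; rewrite hformB in D.
have lt1 : e%:C%C * n.+1%:R * sqnorm_rv c < d * sqnorm_rv c.
  rewrite ltr_pM2r// d_re (_ : n.+1%:R = n.+1%:R%:C%C); last by rewrite rmorph_nat.
  rewrite -rmorphM /= ltcR /e invfM mulrA mulfVK ?pnatr_eq0//.
  by lra.
have lt2 := lt_le_trans (le_lt_trans D lt1) (hd c).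
(* [lt2] makes [hform H c] real and larger than the perturbation, so the approximating form keeps a
   positive real part. This contradicts [form], since that form is [- <A phi, phi>]. *)
have : 0 < complex.Re (hform (Hm m) c).
  move: lt2; set X := hform H c; set Y := hform _ _ => lt2.
  have : `|complex.Re (X - Y)|%:C%C < X.
    apply: le_lt_trans lt2; rewrite normc_def lecR.
    by rewrite -sqrtr_sqr ler_wsqrtr// lerDl sqr_ge0.
  rewrite ltcE /= => /andP[_]; rewrite Re_addE Re_oppE ltr_norml => /andP[_].
  by rewrite ltrBlDr ltrDl.
by rewrite Hmc Re_oppE oppr_gt0 ltNge form.
Unshelve. all: by end_near. Qed.
End Bound.
End EigenvalueBound.

(** * From families of eigenfunctions to the count with multiplicity *)

Section Counting.
Context {R : realType}.
Notation mu := (@lebesgue_measure R).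
Notation C := R[i].

(** The beta integral evaluates [F 1 - F 0] in terms of Gamma values; [F 0 < F 1] is read off from
    the positivity of [Gamma k ^+ 2]. The power [k - 1/2] joins [lam^(k-1)] from Young's constant
    with [sqrt lam] from the boundary term, and its base is [4 lam = 4 alpha + 1]. *)
Lemma mass_constant (alpha k : R) (F : R -> R) : 0 < alpha + 1 / 4 -> 3 / 2 <= k ->
  (forall t : R, -2 < t < 2 -> is_derive t 1 F (soliton k t)) ->
  F 0 < F 1 /\
  young_const k (alpha + 1 / 4) / (4 * Num.sqrt (alpha + 1 / 4) * (F 1 - F 0)) =
  (k - 1) `^ (k - 1) * Gamma (2 * k) /
    ((4 * alpha + 1) `^ (k - 1 / 2) * k `^ k * Gamma k ^+ 2).
Proof.
move=> l0 hk dF; set lam := alpha + 1 / 4 in l0 *.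
have k1 : 1 < k by lra.
have k0 : 0 < k by lra.
have g2 : 0 < Gamma (2 * k) by apply: Gamma_gt0; lra.
have g1 : 0 < Gamma k by exact: Gamma_gt0.
have := Gamma_sqr k1; rewrite (soliton_mass hk dF) -EFinM => -[].
have p4 : 0 < 4 `^ (1 - k) :> R by rewrite powR_gt0.
set X := F 1 - F 0 => GE.
have X0 : 0 < X.
  have : 0 < Gamma k ^+ 2 by rewrite exprn_gt0.
  by rewrite GE pmulr_rgt0// pmulr_rgt0// mulr_gt0.
split; first by rewrite -subr_gt0.
have e4 : 4 `^ (k - 1) * 4 `^ (1 - k) = 1 :> R.
  by rewrite -powRD ?pnatr_eq0 ?implybT// (_ : _ + _ = 0) ?powRr0//; ring.
have half (x : R) : 0 < x -> x `^ (k - 1 / 2) = Num.sqrt x * x `^ (k - 1).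
  move=> x0; have -> : k - 1 / 2 = 2^-1 + (k - 1) by field.
  have xc : (2^-1 + (k - 1) == 0) ==> (x != 0) by rewrite (gt_eqF x0) implybT.
  by rewrite (powRD xc) powR12_sqrt// ltW.
have eh : 4 `^ (k - 1 / 2) = 2 * 4 `^ (k - 1) :> R.
  by rewrite half// (_ : 4 = 2 ^+ 2) ?sqrtr_sqr ?ger0_norm//; ring.
have el := half _ l0.
have -> : 4 * alpha + 1 = 4 * lam by rewrite /lam; field.
rewrite powRM ?(ltW l0)// eh el GE /young_const.
have -> : 4 `^ (1 - k) = (4 `^ (k - 1))^-1 :> R.
  by apply: (mulfI (lt0r_neq0 (powR_gt0 (k - 1) (ltr0n R 4)))); rewrite e4 mulfV// gt_eqF// powR_gt0.
field.
by rewrite !gt_eqF ?powR_gt0 ?sqrtr_gt0// subr_gt0.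
Qed.

(** A bounded set of sizes has a largest element, so the supremum is realised by an actual
    independent family, which can then be combined with those of other eigenvalues. *)
Lemma dimL2_attained (E : set (R -> C)) (B : R) :
  (forall (n : nat) (f : 'I_n -> R -> C), (forall i, E (f i)) -> lin_indep f -> n%:R <= B) ->
  exists (n : nat) (f : 'I_n -> R -> C),
    [/\ forall i, E (f i), lin_indep f & dimL2 E = n%:R%:E].
Proof.
move=> hB; pose P n := `[< exists f : 'I_n -> R -> C, (forall i, E (f i)) /\ lin_indep f >].
have P0 : P 0%N by apply/asboolP; exists (fun _ _ => 0); split=> [[]|c _ []].
have [M hM] : exists M : nat, forall n, P n -> (n <= M)%N.
  exists (Num.bound `|B|) => n /asboolP[f [Ef fi]].
  rewrite -(@ler_nat R) (le_trans (hB _ _ Ef fi))// (le_trans (ler_norm _))// ltW//.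
  exact: archi_boundP.
have exP : exists n, P n by exists 0%N.
case: (ex_maxnP exP hM) => n /asboolP[f [Ef fi]] nmax.
exists n, f; split=> //; apply/eqP; rewrite eq_le; apply/andP; split.
  apply: ge_ereal_sup => _ [m Pm <-]; rewrite lee_fin ler_nat.
  by apply: nmax; exact/asboolP.
by apply: ereal_sup_ubound; exists n => //; exists f.
Qed.

Let Tagged_tagged (I : Type) (T_ : I -> Type) (t : {i : I & T_ i}) : Tagged T_ (tagged t) = t.
Proof. by case: t. Qed.

Lemma sum_dim_bound (ca cb alpha k : R) (F V Qm : R -> R) (s : seq R) :
  let G := closure_op (radial_op ca cb V) in
  0 < alpha + 1 / 4 -> 1 < k ->
  (forall t : R, -2 < t < 2 -> is_derive t 1 F (soliton k t)) -> F 0 < F 1 ->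
  (forall r, 0 < r -> {for r, continuous V}) ->
  (forall r, 0 < r -> 0 <= Qm r) ->
  (forall r, 0 < r -> - Qm r <= (ca - alpha) / r ^+ 2 + cb * r ^+ 2 + V r) ->
  mu.-integrable Rpos (EFin \o mass_density k Qm) -> self_adjoint G ->
  uniq s -> (forall x, x \in s -> x < 0) ->
  (\sum_(x <- s) dimL2 (eigenspace_op G x) <=
   (young_const k (alpha + 1 / 4) / (4 * Num.sqrt (alpha + 1 / 4) * (F 1 - F 0)) *
    \int[mu]_(r in Rpos) mass_density k Qm r)%:E)%E.
Proof.
move=> G halpha hk dF F01 cV Qm0 QQm hi Gsa us s0.
set K := young_const _ _; set c0 := 4 * _ * _; set I := \int[mu]_(r in _) _.
have c00 : 0 < c0 by rewrite !mulr_gt0 ?sqrtr_gt0// subr_gt0.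
have bound (n : nat) (f : 'I_n -> R -> C) (lam : 'I_n -> R) :
    (forall i, lam i < 0) -> (forall i, G (f i, fun r => (lam i)%:C%C * f i r)) ->
    (forall (x : R) (c : 'I_n -> C),
      {ae mu, forall r : R, Rpos r -> \sum_i (if lam i == x then c i else 0) * f i r = 0} ->
      forall i, lam i = x -> c i = 0) -> n%:R <= K / c0 * I.
  move=> lam0 Gf ind; rewrite mulrAC ler_pdivlMr//.
  exact: (eigenfamily_bound halpha hk dF F01 cV Qm0 QQm hi Gsa lam0 Gf ind).
have att x : x < 0 -> exists (n : nat) (f : 'I_n -> R -> C),
    [/\ forall i, eigenspace_op G x (f i), lin_indep f & dimL2 (eigenspace_op G x) = n%:R%:E].
  move=> x0; apply: (@dimL2_attained _ (K / c0 * I)) => n f Ef fi.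
  (* The bound for a single eigenvalue, used to show that its eigenspace has finite dimension. *)
  apply: (bound n f (fun=> x)) => // y c; have [<-|xy _ i yx] := eqVneq x y.
    by move=> /fi h i _; exact: h.
  by rewrite yx eqxx in xy.
have att_s (j : 'I_(size s)) : exists (n : nat) (f : 'I_n -> R -> C),
    [/\ forall i, eigenspace_op G s`_j (f i), lin_indep f &
        dimL2 (eigenspace_op G s`_j) = n%:R%:E].
  by apply: att; apply: s0; exact: mem_nth.
pose N j := projT1 (cid (att_s j)); pose hN j := projT2 (cid (att_s j)).
pose fam j := projT1 (cid (hN j)); pose hfam j := projT2 (cid (hN j)).
(* The bases of all eigenspaces are concatenated into one family indexed by this disjoint union; its
   cardinality is the sum of the dimensions. *)
pose T := {j : 'I_(size s) & 'I_(N j)}.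
pose lam (i : 'I_#|{: T}|) : R := s`_(tag (enum_val i)).
pose f (i : 'I_#|{: T}|) : R -> C := fam (tag (enum_val i)) (tagged (enum_val i)).
have card : #|{: T}| = (\sum_j N j)%N.
  rewrite card_tagged sumnE big_map -[in RHS]big_enum /=.
  by apply: eq_bigr => j _; rewrite card_ord.
have -> : (\sum_(x <- s) dimL2 (eigenspace_op G x) = (#|{: T}|)%:R%:E)%E.
  rewrite (big_nth 0) big_mkord card natr_sum -sumEFin.
  by apply: eq_bigr => j _; have [_ _ ->] := hfam j.
rewrite lee_fin; apply: (bound _ f lam).
- by move=> i; apply: s0; exact: mem_nth.
- by move=> i; rewrite /f /lam; have [h _ _] := hfam (tag (enum_val i)); exact: h.
move=> x c hae i0 hx; set j0 := tag (enum_val i0).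
have [_ ind _] := hfam j0.
pose c' (l : 'I_(N j0)) : C := c (enum_rank (Tagged (fun j => 'I_(N j)) l)).
have c'0 : forall l, c' l = 0.
  apply: ind; apply: (@filterS _ _ (ae_filter_ringOfSetsType mu) _ _ _ hae) => r + r0 => /(_ r0) hr.
  rewrite -[RHS]hr.
  rewrite (reindex (@enum_rank T)) /=; last first.
    by apply: onW_bij; exact: enum_rank_bij.
  transitivity (\sum_(j < size s) \sum_(l < N j)
     (if s`_j == x then c (enum_rank (Tagged (fun j => 'I_(N j)) l)) else 0) * fam j l r).
    (* As [s] has no repetitions, different indices carry different eigenvalues, and only the block
       of [j0] survives. *)
    rewrite (bigD1 j0)//= [X in _ + X]big1 ?addr0 => [|j jj0].
      apply: eq_bigr => l _; congr (_ * _).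
      by rewrite -hx /lam -/j0 eqxx.
    have jx : (s`_j == x) = false.
      apply: contraNF jj0 => jx; rewrite -val_eqE /= -(nth_uniq 0 (ltn_ord j) (ltn_ord j0) us).
      by rewrite (eqP jx) -hx.
    by apply: big1 => l _; rewrite jx mul0r.
  rewrite sig_big_dep /=; apply: eq_bigr => -[j l] _ /=.
  by rewrite /lam /f enum_rankK.
have := c'0 (tagged (enum_val i0)); rewrite /c' => <-.
by rewrite Tagged_tagged enum_valK.
Qed.
End Counting.

Unset Implicit Arguments.

Theorem theoremA1 (R : realType) (a b alpha kappa : R) (V Q Qp Qm : R -> R)
    (ha : - (1 / 4) < a) (ha0 : a != 0) (hb : 0 < b)
    (V_cont : {within `[0, +oo[%classic, continuous V})
    (V_bounded : exists M : R, forall r : R, 0 <= r -> `|V r| <= M)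
    (A_self_adjoint : self_adjoint (closure_op (radial_op a b V)))
    (halpha : - (1 / 4) < alpha) (halpha_a : alpha < a)
    (hQ : forall r : R, 0 < r -> Q r = (a - alpha) / r ^+ 2 + b * r ^+ 2 + V r)
    (Qp_meas : measurable_fun Rpos Qp) (Qm_meas : measurable_fun Rpos Qm)
    (Qp_ge0 : forall r : R, 0 < r -> 0 <= Qp r)
    (Qm_ge0 : forall r : R, 0 < r -> 0 <= Qm r)
    (Q_split : forall r : R, 0 < r -> Q r = Qp r - Qm r)
    (hkappa : 3 / 2 <= kappa) :
  (num_neg_eigenvalues (closure_op (radial_op a b V)) <=
   (((kappa - 1) `^ (kappa - 1) * Gamma (2 * kappa)) /
    ((4 * alpha + 1) `^ (kappa - 1 / 2) * kappa `^ kappa * Gamma kappa ^+ 2))%:E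
   * \int[lebesgue_measure]_(r in Rpos)
       (r `^ (2 * kappa - 1) * Qm r `^ kappa)%:E)%E.
Proof.
have l0 : 0 < alpha + 1 / 4 by lra.
have k1 : 1 < kappa by lra.
(* The open interval contains [[-1, 1]], the range of [v / M], in its interior, so [F] is
   differentiable at the extreme values too. *)
have [F dF] : exists F : R -> R, forall t : R, -2 < t < 2 -> is_derive t 1 F (soliton kappa t).
  by apply: continuous_primitive; [exact: soliton_continuous|lra].
have [F01 cE] := mass_constant l0 hkappa dF.
have cV r : 0 < r -> {for r, continuous V}.
  move=> r0; have /continuous_within_itvcyP[h _] := V_cont.
  by apply: h; rewrite in_itv /= andbT.
have QQm r : 0 < r -> - Qm r <= (a - alpha) / r ^+ 2 + b * r ^+ 2 + V r.
  by move=> r0; rewrite -hQ// Q_split// lerDr Qp_ge0.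
have m0 r : Rpos r -> (0 <= (mass_density kappa Qm r)%:E)%E.
  by rewrite RposE => r0; rewrite lee_fin mulr_ge0 ?powR_ge0.
have mm : measurable_fun Rpos (mass_density kappa Qm).
  apply: measurable_funM; first by apply: measurable_funTS; exact: measurable_powR.
  exact: (measurableT_comp (@measurable_powR R kappa)).
rewrite -cE -/(young_const _ _).
set c := young_const _ _ / _.
have c0 : 0 < c.
  by rewrite divr_gt0 ?young_const_gt0// !mulr_gt0 ?sqrtr_gt0// subr_gt0.
have -> : (\int[lebesgue_measure]_(r in Rpos) (r `^ (2 * kappa - 1) * Qm r `^ kappa)%:E =
    \int[lebesgue_measure]_(r in Rpos) (mass_density kappa Qm r)%:E)%E by [].
have I0 : (0 <= \int[lebesgue_measure]_(r in Rpos) (mass_density kappa Qm r)%:E)%E.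
  exact: integral_ge0.
(* If the integral is infinite, so is the right-hand side, because the constant is positive. *)
have [Ioo|Ifin] := eqVneq (\int[lebesgue_measure]_(r in Rpos) (mass_density kappa Qm r)%:E)%E +oo%E.
  by rewrite Ioo gt0_muley ?lte_fin// leey.
have hi : lebesgue_measure.-integrable Rpos (EFin \o mass_density kappa Qm).
  apply/integrableP; split; first exact/measurable_EFinP.
  under eq_integral => r rp.
    rewrite /= ger0_norm; last by rewrite -lee_fin; apply: m0; rewrite inE in rp.
    over.
  by rewrite ltey.
(* The sum over all negative numbers is a supremum over finite sets of them, so each finite set is
   bounded by [sum_dim_bound]. *)
apply: ge_ereal_sup => _ [A [Afin Aneg] <-].
have h := sum_dim_bound l0 k1 dF F01 cV Qm_ge0 QQm hi A_self_adjoint (finmap.fset_uniq (fset_set A)).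
rewrite fsbig_finite//; apply: le_trans (h _) _.
  by move=> x; rewrite in_fset_set// inE => /Aneg.
rewrite EFinM /Rintegral fineK//.
by rewrite ge0_fin_numE// ltey.
Qed.
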